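(* Let $\mathbb{X}$ be a real Banach space possessing an unconditional Schauder basis $(\mathbf d_l)_{l\in\mathbb N}$. Let $\bm\theta_0\in\mathbb{X}$, let $k\in\mathbb N$ be fixed, let $\bm\alpha=(\alpha_l)_{l\in\mathbb N}$ with $\alpha_l\in(0,1)$, and let $T_{S,\bm\alpha,n,k}=\mathbf q_{S,\bm\alpha}(Z^{(1)}_{\lfloor n/k\rfloor},\dots,Z^{(k)}_{\lfloor n/k\rfloor})$. (1) If $Z_n\stackrel{p}{\to}\bm\theta_0$ as $n\to\infty$, then $T_{S,\bm\alpha,n,k}\stackrel{p}{\to}\bm\theta_0$ as $n\to\infty$. (2) If $a_n(Z_n-\bm\theta_0)\stackrel{d}{\to}Y$ as $n\to\infty$, for some sequence $(a_n)_{n\in\mathbb N}$ of non-negative numbers going to infinity and some $\mathbb X$-valued random variable $Y$, then $a_{\lfloor n/k\rfloor}(T_{S,\bm\alpha,n,k}-\bm\theta_0)\stackrel{d}{\to}\mathbf q_{S,\bm\alpha}(Y_1,\dots,Y_k)$ as $n\to\infty$, where $Y_1,\dots,Y_k$ are i.i.d. copies of $Y$.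
   Context: Univariate quantile: for $\alpha\in(0,1)$ and $\mathbf x\in\mathbb R^k$ with increasingly ordered components $\tilde x_1\le\dots\le\tilde x_k$, $q_\alpha(\mathbf x)=\frac12(\tilde x_{\lceil k\alpha\rceil}+\tilde x_{\lfloor k\alpha+1\rfloor})$. A Schauder basis is unconditional if every convergent series $\sum_l x_l\mathbf d_l$ converges unconditionally. Component-wise quantile with respect to the Schauder basis: if $\mathbf x_i=\sum_{l\in\mathbb N}x_i^{(l)}\mathbf d_l$, $i=1,\dots,k$, then $\mathbf q_{S,\bm\alpha}(\mathbf x_1,\dots,\mathbf x_k)=\sum_{l\in\mathbb N}q_{\alpha_l}(x_1^{(l)},\dots,x_k^{(l)})\,\mathbf d_l$. Estimators: the data are i.i.d. observations. For each $m$, $Z_m$ is an $\mathbb X$-valued estimator of the parameter $\bm\theta_0$, i.e. a random element obtained by applying a fixed map to $m$ observations. A sample of $n$ i.i.d. observations is divided into $k$ disjoint blocks of equal size $\lfloor n/k\rfloor$, and $Z^{(i)}_{\lfloor n/k\rfloor}$ denotes the estimator computed from the observations in block $i$, $i=1,\dots,k$. There is no contamination of the sample in this statement. *)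

(* Defs.v *)
From HB Require Import structures.
From mathcomp Require Import all_boot all_order all_algebra finmap.
From mathcomp Require Import all_classical all_reals all_analysis.

Set Implicit Arguments.
Unset Strict Implicit.
Unset Printing Implicit Defensive.

Import Order.TTheory GRing.Theory Num.Theory.
Import numFieldNormedType.Exports.

Local Open Scope classical_set_scope.
Local Open Scope ring_scope.

(* [s] is 0-indexed: the j-th order statistic (counted from 1) is [s`_j.-1].  For
   0 < a < 1 and 0 < k both ranks lie between 1 and k, so the default value 0
   of [nth] and the absolute values play no role. *)
Definition quantile (R : realType) (k : nat) (a : R) (x : 'I_k -> R) : R :=
  let s := sort <=%R (codom x) in
  (s`_(`|Num.ceil (k%:R * a)|%N.-1) + s`_(`|Num.floor (k%:R * a + 1)|%N.-1)) / 2.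

Section Schauder.
Context (R : realType) (X : completeNormedModType R).
Implicit Types (d : X^nat) (x : X).

Definition schauder_basis d : Prop :=
  forall x, exists! c : R^nat, series (fun l => c l *: d l) @ \oo --> x.

Definition converges_unconditionally (u : X^nat) : Prop :=
  forall s : nat -> nat, bijective s -> cvgn (series (u \o s)).

Definition unconditional_schauder_basis d : Prop :=
  schauder_basis d /\
  forall c : R^nat, cvgn (series (fun l => c l *: d l)) ->
    converges_unconditionally (fun l => c l *: d l).

Definition schauder_coef d x : R^nat :=
  xget (fun=> 0) [set c : R^nat | series (fun l => c l *: d l) @ \oo --> x].

Definition schauder_quantile d (alpha : R^nat) (k : nat) (x : 'I_k -> X) : X :=
  limn (series (fun l =>
    quantile (alpha l) (fun i => schauder_coef d (x i) l) *: d l)).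

End Schauder.

Notation borel X := (g_sigma_algebraType (@open X)).

Section Independence.
Context (R : realType) (dO : measure_display) (Omega : measurableType dO)
  (P : probability Omega R) (dT : measure_display) (T : measurableType dT).

Definition mutually_independent (I : choiceType) (Z : I -> Omega -> T) : Prop :=
  forall (J : {fset I}) (A : I -> set T), (forall i, measurable (A i)) ->
    P (\bigcap_(i in [set` J]) (Z i @^-1` A i)) =
    (\prod_(i <- J) P (Z i @^-1` A i))%E.

End Independence.

Definition same_law (R : realType) (dT : measure_display)
    (T : measurableType dT)
    (dO1 : measure_display) (Omega1 : measurableType dO1)
    (P1 : probability Omega1 R) (Z1 : Omega1 -> T)
    (dO2 : measure_display) (Omega2 : measurableType dO2)
    (P2 : probability Omega2 R) (Z2 : Omega2 -> T) : Prop :=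
  forall A : set T, measurable A -> P1 (Z1 @^-1` A) = P2 (Z2 @^-1` A).

Definition iid (R : realType) (dO : measure_display)
    (Omega : measurableType dO) (P : probability Omega R)
    (dT : measure_display) (T : measurableType dT)
    (I : choiceType) (Z : I -> Omega -> T) : Prop :=
  [/\ forall i, measurable_fun [set: Omega] (Z i),
      mutually_independent P Z &
      forall i j, same_law P (Z i) P (Z j)].

(* Both modes of convergence are between random elements, so Borel
   measurability is part of their definitions. *)
Section Convergence.
Context (R : realType) (X : completeNormedModType R).

Definition random_element (dO : measure_display) (Omega : measurableType dO)
    (Z : Omega -> X) : Prop :=
  measurable_fun [set: Omega] (Z : Omega -> borel X).

Definition cvg_in_probability (dO : measure_display)
    (Omega : measurableType dO) (P : probability Omega R)
    (Z : nat -> Omega -> X) (theta : X) : Prop :=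
  (forall n, random_element (Z n)) /\
  forall eps : R, 0 < eps ->
    P [set w | eps < `|Z n w - theta|] @[n --> \oo] --> 0%E.

Definition cvg_in_distribution (dO : measure_display)
    (Omega : measurableType dO) (P : probability Omega R)
    (Z : nat -> Omega -> X)
    (dO' : measure_display) (Omega' : measurableType dO')
    (P' : probability Omega' R) (Y : Omega' -> X) : Prop :=
  [/\ forall n, random_element (Z n),
      random_element Y &
      forall f : X -> R, continuous f -> bounded_fun f ->
        (\int[P]_w (f (Z n w))%:E)%E @[n --> \oo] -->
        (\int[P']_w (f (Y w))%:E)%E].

End Convergence.

Section Estimators.
Context (dO : measure_display) (Omega : measurableType dO)
  (dE : measure_display) (E : measurableType dE)
  (R : realType) (X : completeNormedModType R).
Variables (g : forall m, m.-tuple E -> X) (xi : nat -> Omega -> E).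

Definition estimator (m : nat) (w : Omega) : X :=
  g [tuple xi j w | j < m].

(* [b n i j] is the position, in the sample [xi 0, ..., xi n.-1], of the j-th
   observation of block i. *)
Definition block_estimator (k : nat)
    (b : forall n, 'I_k -> 'I_(n %/ k) -> 'I_n) (n : nat) (i : 'I_k)
    (w : Omega) : X :=
  g [tuple xi (b n i j) w | j < n %/ k].

Definition disjoint_blocks (k : nat)
    (b : forall n, 'I_k -> 'I_(n %/ k) -> 'I_n) : Prop :=
  forall n, injective (fun p : 'I_k * 'I_(n %/ k) => b n p.1 p.2).

Definition schauder_quantile_estimator (d : X^nat) (alpha : R^nat) (k : nat)
    (b : forall n, 'I_k -> 'I_(n %/ k) -> 'I_n) (n : nat) (w : Omega) : X :=
  schauder_quantile d alpha (fun i => block_estimator b n i w).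

End Estimators.

(* Main.v *)
Require Import Defs.
From mathcomp Require Import finmap.
From HB Require Import structures.
From mathcomp Require Import all_boot all_order all_algebra.
From mathcomp Require Import all_classical all_reals all_analysis.
From mathcomp Require Import measurable_realfun.
From mathcomp Require Import ring lra zify.
Import Order.TTheory GRing.Theory Num.Theory.
Import numFieldNormedType.Exports.
Local Open Scope classical_set_scope.
Local Open Scope ring_scope.

Set Implicit Arguments.
Unset Strict Implicit.
Unset Printing Implicit Defensive.

(** Write [q] for the component-wise quantile map from X^k to X.  Everything
    rests on two properties of [q].

    First, [q] is Lipschitz, and this is where unconditionality enters.  A
    quantile of k real numbers moves by at most the sum of the displacements
    of its arguments, so the l-th coordinate of [q x - q y] is a combination
    of the l-th coordinates of the [x i - y i] with multipliers bounded by 1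
    ([quantile_difference]).  For an unconditional basis, multiplying
    coordinates by numbers bounded by 1 is a bounded operation, with one
    constant K for all multiplier sequences ([unconditional_constant]).  Hence
    the norm of [q x - q y] is at most K times the sum of the norms of the
    [x i - y i] ([schauder_quantile_lipschitz]).  The constant K comes from the
    argument of the open mapping theorem: by Baire's theorem a ball is contained
    in the closure of a set on which all multipliers act with a common bound,
    and successive approximation removes the closure.  That the multipliers
    have some bound at each single vector is the classical fact that
    unconditional convergence makes all partial sums over subsets of a tail
    small ([unconditional_tail]), for otherwise a rearrangement would
    diverge.

    Second, [q] commutes with x |-> t x + c for t >= 0
    ([schauder_quantile_affine]), because quantiles of reals do.

    Consistency follows at once: [q] maps the constant family theta0 to theta0,
    so an error of T forces an error of some block estimator, and each of the
    k block estimators is distributed like Z at the block size.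

    For the limit law, affine equivariance rewrites the normalised error of T
    as [q] applied to the normalised errors of the blocks.  These are
    independent and have a common law which converges weakly to that of Y, so
    what has to be shown is that the joint law converges to that of
    independent copies of Y, tested against h = f o q.  It suffices to take f
    bounded and Lipschitz ([portmanteau_lipschitz]), and then h is bounded and
    Lipschitz on X^k.  The space X is separable because it has a basis; a
    partition of unity subordinate to small balls around a dense sequence,
    truncated after finitely many functions, approximates h by a finite
    combination of products of functions of one variable
    ([grid_approx_error]).  The mean of such a product factors by
    independence, hence converges.  The error is controlled by the mean of the
    part of the partition that was cut off, a single continuous function whose
    mean is small under Y and so eventually small along the sequence
    ([product_weak_convergence]). *)

(** * Rearrangements and unconditional convergence *)

(** Inside each block from [M j] to [M j.+1] the indices satisfying [Q j] are
    listed first. The new order still enumerates every block completely, hence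
    is a permutation of the integers, and the sum over the selected indices of
    a block becomes a sum over consecutive terms of the rearranged series. *)
Lemma block_rearrangement (M : nat -> nat) (Q : nat -> pred nat) :
  M 0%N = 0%N -> {homo M : i j / (i < j)%N} ->
  exists2 s : nat -> nat, bijective s &
    forall (V : zmodType) (u : nat -> V) j, exists2 c,
      (M j + c <= M j.+1)%N &
      \sum_(M j <= i < M j + c) u (s i) = \sum_(M j <= l < M j.+1 | Q j l) u l.
Proof.
move=> M0 Minc.
have Mle : {homo M : i j / (i <= j)%N} by exact: ltnW_homo.
have exJ n : exists j, (M j <= n < M j.+1)%N.
  elim: n => [|n [j /andP[Mj nM]]].
    by exists 0%N; rewrite M0 /= -M0; exact: Minc.
  have [nM'|Mn] := ltnP n.+1 (M j.+1).
    by exists j; rewrite nM' (leq_trans Mj).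
  exists j.+1; rewrite Mn /= (leq_ltn_trans nM)//.
  exact: Minc.
have [J HJ] := choice exJ.
have JP n j : (M j <= n < M j.+1)%N -> J n = j.
  move=> /andP[Mj nM]; have /andP[Mj' nM'] := HJ n.
  apply/eqP; rewrite eqn_leq; apply/andP; split; rewrite leqNgt; apply/negP.
    by move=> /Mle => /(leq_trans nM); rewrite ltnNge Mj'.
  by move=> /Mle => /(leq_trans nM'); rewrite ltnNge Mj.
pose I j := index_iota (M j) (M j.+1).
pose t j := [seq l <- I j | Q j l] ++ [seq l <- I j | ~~ Q j l].
have tI j : perm_eq (t j) (I j) by apply/permPl/perm_filterC.
have tu j : uniq (t j) by rewrite (perm_uniq (tI j)) iota_uniq.
have tm j l : (l \in t j) = (M j <= l < M j.+1)%N.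
  by rewrite (perm_mem (tI j)) mem_index_iota.
have ts j : size (t j) = (M j.+1 - M j)%N by rewrite (perm_size (tI j)) size_iota.
pose s n := nth 0%N (t (J n)) (n - M (J n)).
(* The inverse of s: the position of m in the list of its own block. *)
pose s' m := (M (J m) + index m (t (J m)))%N.
have offlt n : (n - M (J n) < size (t (J n)))%N.
  by have /andP[? ?] := HJ n; rewrite ts ltn_sub2r// (leq_ltn_trans _ (_ : n < _)%N).
have Js n : J (s n) = J n by apply: JP; rewrite -tm mem_nth.
have mt m : m \in t (J m) by rewrite tm HJ.
have Js' m : J (s' m) = J m.
  apply: JP; rewrite leq_addr /= /s'.
  have : (index m (t (J m)) < M (J m).+1 - M (J m))%N by rewrite -ts index_mem.
  by rewrite ltn_subRL.
exists s.
  exists s' => [n|m].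
    rewrite /s' Js /s index_uniq// subnKC//.
    by have /andP[] := HJ n.
  by rewrite /s Js' /s' addKn nth_index.
move=> V u j; exists (size [seq l <- I j | Q j l]).
  have /leq_ltn_trans := Minc _ _ (ltnSn j).
  rewrite -leq_subRL; last exact/ltnW/Minc.
  by rewrite -(ts j) size_cat leq_addr.
rewrite -[RHS]big_filter -/(I j).
set F := [seq _ <- _ | _].
rewrite [RHS](big_nth 0%N) -{1}[M j]add0n big_addn addKn.
rewrite big_nat [RHS]big_nat; apply: eq_bigr => i /= iF.
congr u; rewrite /s.
have -> : J (i + M j)%N = j.
  apply: JP; rewrite leq_addl/= addnC -ltn_subRL.
  by rewrite -ts size_cat (leq_trans iF) ?leq_addr.
by rewrite addnK nth_cat iF.
Qed.

Lemma cvg_sum_seq (R : numFieldType) (V : normedModType R) (T I : Type)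
    (F : set_system T) (FF : Filter F) (r : seq I) (f : I -> T -> V) (a : I -> V) :
  (forall i, f i @ F --> a i) ->
  (fun x => \sum_(i <- r) f i x) @ F --> \sum_(i <- r) a i.
Proof.
move=> fa; elim: r => [|i r IH].
  by under eq_fun do rewrite big_nil; rewrite big_nil; exact: cvg_cst.
under eq_fun do rewrite big_cons.
by rewrite big_cons; apply: cvgD.
Qed.

Section NormedSeries.
Context (R : realType) (X : completeNormedModType R).
Implicit Types (u : nat -> X).

Lemma cvgn_series_tail u : cvgn (series u) -> forall eps : R, 0 < eps ->
  exists N, forall m n, (N <= m)%N -> `|\sum_(m <= l < n) u l| < eps.
Proof.
move=> /cauchy_cvgP /cauchy_seriesP H eps e0.
have [[A B]/= [[N1 _ H1] [N2 _ H2]] HAB] := H _ e0.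
exists (maxn N1 N2) => m n; rewrite geq_max => /andP[N1m N2m].
have [nm|mn] := ltnP n m; first by rewrite big_geq ?normr0// ltnW.
by apply: (HAB (m, n)); split; [exact: H1|apply/H2/(leq_trans N2m)].
Qed.

(** If the subset sums of the tails did not become small, there would be
    consecutive blocks each containing a subset with sum larger than [eps];
    the permutation that lists these subsets first in their blocks would give
    a series that is not Cauchy. *)
Lemma unconditional_tail u : converges_unconditionally u ->
  forall eps : R, 0 < eps -> exists N, forall (P : pred nat) m n, (N <= m)%N ->
    `|\sum_(m <= l < n | P l) u l| <= eps.
Proof.
move=> cu eps e0; apply: contrapT => /forallNP H.
have {}H N : exists p : pred nat * nat * nat,
    (N <= p.1.2)%N /\ eps < `|\sum_(p.1.2 <= l < p.2 | p.1.1 l) u l|.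
  have /existsNP[P /existsNP[m /existsNP[n]]] := H N.
  move=> /not_implyP[Nm /negP]; rewrite -ltNge => he.
  by exists (P, m, n).
have [c Hc] := choice H.
(* [c N] is a subset and an interval beyond N on which its sum is large. The
   blocks end where these intervals end. *)
pose M := fix M j := if j is j'.+1 then (c (M j')).2 else 0%N.
have cmn N : ((c N).1.2 < (c N).2)%N.
  have [_ + ] := Hc N.
  rewrite ltnNge; apply: contraPN => le.
  by rewrite big_geq// normr0; apply/negP; rewrite -leNgt ltW.
have Minc : {homo M : i j / (i < j)%N}.
  apply: homo_ltn; first exact: ltn_trans.
  by move=> i; rewrite (leq_ltn_trans _ (cmn (M i)))//; have [] := Hc (M i).
pose Q j l := ((c (M j)).1.2 <= l)%N && (c (M j)).1.1 l.
have [s sb Hs] := @block_rearrangement M Q erefl Minc.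
have [N HN] := cvgn_series_tail (cu s sb) e0.
have [cN _ E] := Hs _ u N.
have NM : (N <= M N)%N.
  elim: N {HN cN E} => // N; move/leq_ltn_trans; apply.
  exact: Minc.
have := HN (M N) (M N + cN)%N NM.
rewrite E; apply/negP; rewrite -leNgt ltW//.
have [h1 h2] := Hc (M N); rewrite (lt_le_trans h2)//.
have -> // : \sum_(M N <= l < M N.+1 | Q N l) u l =
    \sum_((c (M N)).1.2 <= l < (c (M N)).2 | (c (M N)).1.1 l) u l.
(* No index of the block below the start of the interval satisfies [Q N]. *)
rewrite (big_cat_nat h1)/=; last exact: ltnW.
rewrite big_nat_cond big_pred0 ?add0r; last first.
  by move=> i; rewrite /Q; case: (ltnP i) => //; rewrite ?andbF.
rewrite big_nat_cond [RHS]big_nat_cond; apply: eq_bigl => i.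
by rewrite /Q; case: (leqP (c (M N)).1.2 i) => //=; rewrite andbF.
Qed.

End NormedSeries.

Section Multipliers.
Context (R : realType) (X : normedModType R).
Implicit Types (u : nat -> X) (r : seq nat).

(** A sum with weights in the unit interval is a convex combination of the
    sums over sub-families, and balls are convex. The free vector [v] makes
    the induction on the family go through. *)
Lemma norm_sum_convex r u (v : X) (lam : nat -> R) C :
  (forall l, 0 <= lam l <= 1) ->
  (forall s, subseq s r -> `|v + \sum_(l <- s) u l| <= C) ->
  `|v + \sum_(l <- r) lam l *: u l| <= C.
Proof.
move=> l01; elim: r v => [|a r IH] v H.
  by have := H [::] isT; rewrite !big_nil.
rewrite big_cons.
have /andP[la0 la1] := l01 a.
set S := \sum_(_ <- r) _.
have -> : v + (lam a *: u a + S) =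
    lam a *: (v + u a + S) + (1 - lam a) *: (v + S).
  rewrite [v + u a + S]addrAC (scalerDr _ (v + S)) scalerBl scale1r.
  by rewrite [RHS]addrC [RHS]addrA subrK [_ + S]addrC addrA.
rewrite (le_trans (ler_normD _ _))// !normrZ (ger0_norm la0) ger0_norm ?subr_ge0//.
have h1 : `|v + u a + S| <= C.
  by apply: IH => s sr; have := H (a :: s); rewrite big_cons addrA; apply; rewrite /= eqxx.
have h2 : `|v + S| <= C.
  by apply: IH => s sr; rewrite H// (subseq_trans sr)// subseq_cons.
have -> : C = lam a * C + (1 - lam a) * C by ring.
by rewrite lerD// ler_wpM2l// subr_ge0.
Qed.

(** A weight in [-1, 1] is the difference of two weights in [0, 1], whence the
    factor 2. *)
Lemma norm_sum_multiplier r u (lam : nat -> R) C : uniq r ->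
  (forall l, `|lam l| <= 1) ->
  (forall P : pred nat, `|\sum_(l <- r | P l) u l| <= C) ->
  `|\sum_(l <- r) lam l *: u l| <= C *+ 2.
Proof.
move=> ur l1 H.
have Hs s : subseq s r -> `|0 + \sum_(l <- s) u l| <= C.
  by move=> /(subseq_uniqP ur) ->; rewrite add0r big_filter.
pose lp l := Num.max 0 (lam l); pose ln l := Num.max 0 (- lam l).
have -> : \sum_(l <- r) lam l *: u l =
    (0 + \sum_(l <- r) lp l *: u l) - (0 + \sum_(l <- r) ln l *: u l).
  rewrite !add0r -sumrB; apply: eq_bigr => l _; rewrite -scalerBl; congr (_ *: _).
  rewrite /lp /ln /Num.max oppr_gt0; case: ltgtP => // h; rewrite ?subr0 ?sub0r ?opprK//.
rewrite mulr2n (le_trans (ler_normB _ _))// lerD// norm_sum_convex// => l.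
  rewrite /lp; have := l1 l; rewrite ler_norml => /andP[? ?].
  by rewrite le_max lexx ge_max ler01.
rewrite /ln; have := l1 l; rewrite ler_norml => /andP[? ?].
by rewrite le_max lexx ge_max ler01/= lerNl.
Qed.

End Multipliers.

(** * Coordinate multipliers of an unconditional basis *)

Section UnconditionalConstant.
Context (R : realType) (X : completeNormedModType R) (d : nat -> X).
Hypothesis hd : unconditional_schauder_basis d.
Local Notation coef := (schauder_coef d).

Lemma schauder_coefP x : series (fun l => coef x l *: d l) @ \oo --> x.
Proof.
rewrite /schauder_coef; case: xgetP => [c _ //|H].
by have [c [/H]] := hd.1 x.
Qed.

Lemma schauder_coef_unique x (c : nat -> R) :
  series (fun l => c l *: d l) @ \oo --> x -> coef x = c.
Proof.
move=> cx; have [c' [_ U]] := hd.1 x.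
by rewrite -(U _ cx) -(U _ (@schauder_coefP x)).
Qed.

Lemma schauder_coef_lin a x y l :
  coef (a *: x + y) l = a * coef x l + coef y l.
Proof.
suff -> : coef (a *: x + y) = (fun l => a * coef x l + coef y l) by [].
apply: schauder_coef_unique.
have -> : series (fun l => (a * coef x l + coef y l) *: d l) =
    (fun n => a *: series (fun l => coef x l *: d l) n
              + series (fun l => coef y l *: d l) n).
  apply/funext => n; rewrite /series/= scaler_sumr -big_split/=.
  by apply: eq_bigr => i _; rewrite scalerDl scalerA.
by apply: cvgD; [apply: cvgZr|]; exact: schauder_coefP.
Qed.

Lemma schauder_coef0 l : coef 0 l = 0.
Proof. by have := schauder_coef_lin 1 0 0 l; rewrite scaler0 addr0; lra. Qed.

Lemma schauder_coefB x y l : coef (x - y) l = coef x l - coef y l.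
Proof.
by rewrite addrC -scaleN1r schauder_coef_lin mulN1r addrC.
Qed.

Lemma schauder_coefD x y l : coef (x + y) l = coef x l + coef y l.
Proof. by rewrite -[x]scale1r schauder_coef_lin mul1r scale1r. Qed.

Lemma schauder_coefZ a x l : coef (a *: x) l = a * coef x l.
Proof. by rewrite -[a *: x]addr0 schauder_coef_lin schauder_coef0 addr0. Qed.

Lemma schauder_basis_neq0 l : d l != 0.
Proof.
apply/eqP => dl0.
have : (fun=> 0 : R) = (fun i => (i == l)%:R : R).
  rewrite -(_ : coef 0 = fun=> 0); last by apply/funext => i; exact: schauder_coef0.
  apply: schauder_coef_unique.
  rewrite (_ : series _ = fun=> 0); first exact: cvg_cst.
  apply/funext => n; rewrite /series/= big1// => i _.
  by have [->|_] := eqVneq i l; rewrite ?dl0 ?scaler0 ?scale0r.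
by move=> /(congr1 (fun f => f l)); rewrite eqxx => /eqP; rewrite eq_sym oner_eq0.
Qed.

(** Says that x has gauge at most C, the gauge being the supremum of these
    norms over N and lam. The supremum itself is not formed, since it is not
    known to be finite at first. *)
Definition multipliers_bounded (x : X) (C : R) := forall N (lam : nat -> R),
  (forall l, `|lam l| <= 1) ->
  `|\sum_(0 <= l < N) (lam l * coef x l) *: d l| <= C.
Local Notation mb := multipliers_bounded.

(** The subset sums of a tail control all its multiplied sums at once, so one
    N serves every multiplier sequence. *)
Lemma schauder_tail x (eps : R) : 0 < eps -> exists N,
  forall (lam : nat -> R) m n, (forall l, `|lam l| <= 1) -> (N <= m)%N ->
    `|\sum_(m <= l < n) (lam l * coef x l) *: d l| <= eps.
Proof.
move=> e0; have cx : cvgn (series (fun l => coef x l *: d l)).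
  by apply/cvg_ex; exists x; exact: schauder_coefP.
have e20 : 0 < eps / 2 by rewrite divr_gt0.
have [N HN] := unconditional_tail (hd.2 _ cx) e20.
exists N => lam m n l1 Nm.
under eq_bigr do rewrite -scalerA.
have -> : eps = (eps / 2) *+ 2 by rewrite -mulr_natr divfK.
by apply: norm_sum_multiplier => //; [exact: iota_uniq|move=> P; exact: HN].
Qed.

Lemma multipliers_bounded_ex x : exists C, mb x C.
Proof.
have [N0 H] := schauder_tail x ltr01.
exists (\sum_(0 <= l < N0) `|coef x l| * `|d l| + 1) => N lam l1.
have le1 n : (n <= N0)%N -> `|\sum_(0 <= l < n) (lam l * coef x l) *: d l| <=
    \sum_(0 <= l < N0) `|coef x l| * `|d l|.
  move=> nN; rewrite (le_trans (ler_norm_sum _ _ _))// [leRHS](big_cat_nat (n := n))//=.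
  rewrite -[leLHS]addr0 lerD ?sumr_ge0// ler_sum// => l _.
  by rewrite normrZ normrM -mulrA ler_piMl ?mulr_ge0.
have [NN|NN] := leqP N N0; first by rewrite (le_trans (le1 _ NN))// lerDl.
rewrite (big_cat_nat (n := N0)) ?(ltnW NN)//= (le_trans (ler_normD _ _))//.
by rewrite lerD ?le1 ?H.
Qed.

Lemma multipliers_boundedD x y C D : mb x C -> mb y D -> mb (x + y) (C + D).
Proof.
move=> Hx Hy N lam l1.
under eq_bigr do rewrite schauder_coefD mulrDr scalerDl.
by rewrite big_split/= (le_trans (ler_normD _ _))// lerD ?Hx ?Hy.
Qed.

Lemma multipliers_boundedZ a x C : mb x C -> mb (a *: x) (`|a| * C).
Proof.
move=> Hx N lam l1.
under eq_bigr do rewrite schauder_coefZ mulrCA -scalerA.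
by rewrite -scaler_sumr normrZ ler_wpM2l ?Hx.
Qed.

Lemma multipliers_boundedB x y C D : mb x C -> mb y D -> mb (x - y) (C + D).
Proof.
move=> Hx Hy; apply: multipliers_boundedD => //.
by have := multipliers_boundedZ (-1) Hy; rewrite scaleN1r normrN1 mul1r.
Qed.

Lemma multipliers_bounded_le x C D : C <= D -> mb x C -> mb x D.
Proof. by move=> CD H N lam l1; rewrite (le_trans (H _ _ l1)). Qed.

Lemma multipliers_bounded_coef x C l : mb x C -> `|coef x l| * `|d l| <= C.
Proof.
move=> /(_ l.+1 (fun i => (i == l)%:R)); rewrite big_nat_recr//=.
rewrite big_nat big1 ?add0r; last first.
  by move=> i /andP[_ il]; rewrite (ltn_eqF il) mul0r scale0r.
rewrite eqxx mul1r normrZ; apply => i.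
by case: eqP; rewrite ?normr1 ?normr0.
Qed.

(** The vectors with gauge at most n exhaust X, so by Baire's theorem the
    closure of one of these sets contains a ball. Differences of two of its
    points approximate every small vector, and their gauge is at most 2n. *)
Lemma multipliers_bounded_dense : exists r C : R, [/\ 0 < r, 0 <= C &
  forall y, `|y| < r -> forall eps : R, 0 < eps ->
    exists2 z, mb z C & `|y - z| < eps].
Proof.
pose F n := ~` closure [set x | mb x n%:R].
have Fo n : open (F n) by apply: closed_openC; exact: closed_closure.
have [n nd] : exists n, ~ dense (F n).
  apply: contrapT => /forallNP H.
  have /Baire : forall n, open (F n) /\ dense (F n).
    by move=> n; split=> //; apply: contrapT; exact: H.
  move=> /(_ setT); case=> [||x [_ Fx]]; [by exists 0|exact: openT|].
  have [C HC] := multipliers_bounded_ex x.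
  pose n := `|Num.ceil C|%N.
  apply: (Fx n I); apply: subset_closure.
  apply: multipliers_bounded_le HC.
  by rewrite (le_trans (Num.Theory.ceil_ge C))// natr_absz ler_int ler_norm.
move: nd => /existsNP[V /not_implyP[[x0 Vx0] /not_implyP[oV VF]]].
have cV y : V y -> closure [set x | mb x n%:R] y.
  by move=> Vy; apply: contrapT => Fy; apply: VF; exists y.
have /nbhs_ballP[r /= r0 rV] : nbhs x0 V by exact: open_nbhs_nbhs.
exists r, (n%:R + n%:R); split => //.
move=> y yr eps e0.
have e20 : 0 < eps / 2 by rewrite divr_gt0.
have ap v : V v -> exists2 z, mb z n%:R & `|v - z| < eps / 2.
  move=> /cV /(_ _ (nbhsx_ballx v _ e20)) [z [/= mz zv]].
  by exists z => //; move: zv; rewrite -ball_normE.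
have [a ma ha] : exists2 z, mb z n%:R & `|x0 + y - z| < eps / 2.
  by apply/ap/rV; rewrite -ball_normE /ball_/= opprD addrA subrr add0r normrN.
have [b mb' hb] := ap _ Vx0.
exists (a - b); first exact: multipliers_boundedB.
have -> : y - (a - b) = (x0 + y - a) - (x0 - b).
  by rewrite -(addrA x0) [x0 + (y - a)]addrC addrKA opprK opprB addrA addrAC.
by rewrite (le_lt_trans (ler_normB _ _))// [ltRHS]splitr ltrD.
Qed.

Lemma multipliers_bounded0 : mb 0 0.
Proof.
move=> N lam _; rewrite big1 ?normr0// => i _.
by rewrite schauder_coef0 mulr0 scale0r.
Qed.

(** Completeness for the gauge. A sequence which is Cauchy for the gauge has
    converging coordinates, because the gauge dominates each of them. Their
    limits are the coordinates of the norm limit, because the partial sums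
    formed with them differ from those of [w J] by at most [eps J], uniformly
    in their length. *)
Lemma multipliers_bounded_lim (w : nat -> X) x (eps : nat -> R) C :
  eps @ \oo --> 0 -> w @ \oo --> x ->
  (forall J i, mb (w (J + i)%N - w J) (eps J)) -> mb (w 0%N) C ->
  mb x (C + eps 0%N).
Proof.
move=> eps0 wx Hw H0.
(* The gauge controls each coordinate since the l-th basis vector is
   nonzero. *)
have ce l : exists c : R, coef (w J) l @[J --> \oo] --> c.
  apply/cvg_ex/cauchy_cvgP/cauchy_exP => e e0.
  have dl : 0 < `|d l| by rewrite normr_gt0 schauder_basis_neq0.
  have [J _ HJ] : \forall n \near \oo, `|0 - eps n| < e * `|d l|.
    by move/cvgrPdist_lt : eps0; apply; rewrite mulr_gt0.
  exists (coef (w J) l); exists J => // n /= Jn.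
  rewrite -ball_normE /ball_/= distrC -schauder_coefB -(ltr_pM2r dl).
  have := multipliers_bounded_coef l (Hw J (n - J)%N); rewrite subnKC//.
  move/le_lt_trans; apply; rewrite (le_lt_trans _ (HJ J _))//=.
  by rewrite sub0r normrN ler_norm.
have [c cP] := choice ce.
have cw J N lam : (forall l, `|lam l| <= 1) ->
    `|\sum_(0 <= l < N) (lam l * (c l - coef (w J) l)) *: d l| <= eps J.
  move=> l1.
  suff : `|\sum_(0 <= l < N) (lam l * (coef (w (J + i)%N) l - coef (w J) l)) *: d l|
      @[i --> \oo] -->
      `|\sum_(0 <= l < N) (lam l * (c l - coef (w J) l)) *: d l|.
    move=> h; rewrite -(cvg_lim _ h)//; apply: limr_le; first exact: cvgP h.
    near=> i.
    under eq_bigr do rewrite -schauder_coefB.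
    exact: Hw.
  apply: cvg_norm; apply: cvg_sum_seq => l.
  apply: cvgZr_tmp; apply: cvgMl_tmp; apply: cvgB; last exact: cvg_cst.
  exact: cvg_comp (cvg_addnl J) (cP l).
have cx : coef x = c.
  apply: schauder_coef_unique; apply/cvgrPdist_lt => e e0.
  have e3 : 0 < e / 3 by rewrite divr_gt0.
  have [J1 _ HJ1] : \forall n \near \oo, `|0 - eps n| < e / 3.
    by move/cvgrPdist_lt : eps0; exact.
  have [J2 _ HJ2] : \forall n \near \oo, `|x - w n| < e / 3.
    by move/cvgrPdist_lt : wx; exact.
  pose J := maxn J1 J2.
  have /cvgrPdist_lt/(_ _ e3) := @schauder_coefP (w J).
  apply: filterS => N HN.
  have h1 := HJ2 J (leq_maxr _ _).
  have h2 : `|\sum_(0 <= l < N) (1 * (c l - coef (w J) l)) *: d l| < e / 3.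
    apply: le_lt_trans (cw J N (fun=> 1) _) _ => [l|]; first by rewrite normr1.
    rewrite (le_lt_trans _ (HJ1 J (leq_maxl _ _)))//.
    by rewrite sub0r normrN ler_norm.
  (* For a fixed good J the first term is small by norm convergence, the
     second for large N, and the third for all N at once. *)
  have -> : x - series (fun l => c l *: d l) N = (x - w J) +
     (w J - series (fun l => coef (w J) l *: d l) N) -
     \sum_(0 <= l < N) (1 * (c l - coef (w J) l)) *: d l.
    rewrite subrKA; under [\sum_(_ <= _ < _) (1 * _) *: _]eq_bigr do rewrite mul1r scalerBl.
    by rewrite sumrB opprB addrA subrK.
  rewrite (le_lt_trans (ler_normB _ _))//.
  rewrite (_ : e = e / 3 + e / 3 + e / 3); last by field.
  by rewrite ltrD// (le_lt_trans (ler_normD _ _))// ltrD.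
move=> N lam l1; rewrite cx.
have -> : \sum_(0 <= l < N) (lam l * c l) *: d l =
    \sum_(0 <= l < N) (lam l * coef (w 0%N) l) *: d l +
    \sum_(0 <= l < N) (lam l * (c l - coef (w 0%N) l)) *: d l.
  by rewrite -big_split; apply: eq_bigr => l _; rewrite /= -scalerDl mulrBr addrC subrK.
by rewrite (le_trans (ler_normD _ _))// lerD ?H0 ?cw.
Unshelve. all: by end_near.
Qed.

(** A small vector is approximated by one of gauge at most C, the remainder by
    one of gauge C/2, and so on; the sum of these approximations has gauge at
    most 2C. Homogeneity then yields the bound for all vectors. *)
Lemma unconditional_constant : exists2 K : R, 0 <= K &
  forall x, multipliers_bounded x (K * `|x|).
Proof.
have [r [C [r0 C0 H]]] := multipliers_bounded_dense.
pose h j : R := 2 ^- j.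
have h0 j : 0 < h j by rewrite invr_gt0 exprn_gt0.
have hS j : h j.+1 = h j / 2 by rewrite /h exprS invfM mulrC.
(* One step of the approximation, at scale [h j]: the bound on the remainder
   is halved. *)
have step j y : exists z, `|y| < r * h j ->
    mb z (C * h j) /\ `|y - z| < r * h j.+1.
  have [yr|yr] := ltP `|y| (r * h j); last by exists 0.
  have [||z mz zr] := H ((h j)^-1 *: y) _ (r / 2).
  - by rewrite normrZ gtr0_norm ?invr_gt0// ltr_pdivrMl// mulrC.
  - by rewrite divr_gt0.
  exists (h j *: z) => _; split.
    by have := multipliers_boundedZ (h j) mz; rewrite gtr0_norm// mulrC.
  rewrite -[y](scalerKV (lt0r_neq0 (h0 j))) -scalerBr normrZ gtr0_norm//.
  by rewrite hS mulrCA ltr_pM2l.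
have [Z ZP] := choice (fun p : nat * X => step p.1 p.2).
suff K1 x : `|x| < r -> mb x (C * 2).
  exists (C * 2 * (2 / r)); first by rewrite !mulr_ge0// invr_ge0 ltW.
  move=> x; have [->|x0] := eqVneq x 0.
    by rewrite normr0 mulr0; exact: multipliers_bounded0.
  have nx : 0 < `|x| by rewrite normr_gt0.
  pose t := 2 / r * `|x|.
  have t0 : 0 < t by rewrite !mulr_gt0// invr_gt0.
  have := @K1 (t^-1 *: x); rewrite normrZ gtr0_norm ?invr_gt0//.
  have -> : t^-1 * `|x| = r / 2.
    by rewrite /t; field; rewrite ?lt0r_neq0.
  move=> /(_ _)/(multipliers_boundedZ t).
  rewrite scalerKV ?lt0r_neq0// gtr0_norm// /t [_ * (C * 2)]mulrC mulrA.
  apply.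
  by rewrite ltr_pdivrMr// ltr_pMr// ltr1n.
move=> xr.
(* [y j] is the remainder after j steps; the approximations of x are x - y
   j. *)
pose y := fix y j := if j is j'.+1 then y j' - Z (j', y j') else x.
have yr j : `|y j| < r * h j.
  elim: j => [|j IH] /=; first by rewrite /h expr0 invr1 mulr1.
  by have [] := ZP (j, y j) IH.
have mz j : mb (Z (j, y j)) (C * h j) by have [] := ZP (j, y j) (yr j).
have h_0 : h @ \oo --> 0.
  rewrite (_ : h = fun j => 1 * (2^-1) ^+ j).
    by apply: cvg_geometric; rewrite gtr0_norm ?invr_gt0// invf_lt1// ltr1n.
  by apply/funext => j; rewrite mul1r /h exprVn.
have wx : (x - y j) @[j --> \oo] --> x.
  apply/cvgrPdist_lt => e e0.
  have : \forall j \near \oo, `|0 - h j| < e / r.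
    by move/cvgrPdist_lt : h_0; apply; rewrite divr_gt0.
  apply: filterS => j; rewrite sub0r normrN gtr0_norm// ltr_pdivlMr// mulrC.
  by move=> hj; rewrite opprB addrC subrK (lt_trans (yr j)).
have -> : C * 2 = 0 + (C * 2) * h 0%N by rewrite /h expr0 invr1 mulr1 add0r.
apply: (multipliers_bounded_lim (eps := fun j => (C * 2) * h j) _ wx) => //.
- rewrite -[X in _ --> X](mulr0 (C * 2)); exact: cvgMr.
(* The geometric sum of the bounds from J to J + i, in a form that is provable
   by induction on i. *)
- move=> J i; apply: (multipliers_bounded_le (C := C * 2 * (h J - h (J + i)%N))).
    by rewrite ler_wpM2l ?mulr_ge0// gerBl ltW.
  elim: i => [|i IH].
    by rewrite addn0 !subrr mulr0; exact: multipliers_bounded0.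
  rewrite addnS /=.
  have -> : x - (y (J + i)%N - Z ((J + i)%N, y (J + i)%N)) - (x - y J) =
      (x - y (J + i)%N - (x - y J)) + Z ((J + i)%N, y (J + i)%N).
    by rewrite [RHS]addrAC; congr (_ - _); rewrite opprD opprK addrA.
  have -> : C * 2 * (h J - h (J + i).+1) =
      C * 2 * (h J - h (J + i)%N) + C * h (J + i)%N by rewrite hS; field.
  exact: multipliers_boundedD.
- by rewrite /= subrr; exact: multipliers_bounded0.
Qed.

End UnconditionalConstant.

(** * Sample quantiles *)

Section Quantile.
Context (R : realType) (k : nat) (hk : (0 < k)%N).
Implicit Types (x y : 'I_k -> R) (a : R).

Definition order_stat x (j : nat) : R := (sort <=%R (codom x))`_j.

Lemma size_order_stat x : size (sort <=%R (codom x)) = k.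
Proof. by rewrite size_sort size_codom card_ord. Qed.

(** In a sorted list the entries that are at most t form a prefix. The
    right-hand side no longer mentions sorting, so that monotonicity of order
    statistics can be read off from it. *)
Lemma order_stat_le x j t : (j < k)%N ->
  (order_stat x j <= t) = (j < #|[pred i | (x i <= t)%R]|)%N.
Proof.
move=> jk; have srt := sort_le_sorted (codom x).
rewrite -[RHS](_ : (j < count (fun r => (r <= t)%R) (sort <=%R (codom x)))%N = _).
  set s := sort _ _ in srt *.
  have js : (j < size s)%N by rewrite size_order_stat.
  apply/idP/idP => [h|].
    rewrite -(cat_take_drop j.+1 s) count_cat ltn_addr//.
    suff /eqP -> : count (fun r => (r <= t)%R) (take j.+1 s) == size (take j.+1 s).
      by rewrite size_takel.
    rewrite -all_count; apply/(all_nthP 0) => i.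
    rewrite size_takel// ltnS => ij; rewrite nth_take ?ltnS//.
    apply: le_trans h; rewrite /order_stat -/s.
    by apply: (sorted_leq_nth le_trans lexx) => //; rewrite inE ?(leq_ltn_trans ij).
  apply: contraLR; rewrite -ltNge -leqNgt => h.
  rewrite -(cat_take_drop j s) count_cat.
  rewrite [X in (_ + X)%N](_ : _ = 0%N) ?addn0.
    by rewrite (leq_trans (count_size _ _))// size_takel// ltnW.
  apply/eqP; rewrite -leqn0 leqNgt -has_count; apply/negP => /(has_nthP 0)[i].
  rewrite size_drop ltn_subRL => ji; rewrite nth_drop; apply/negP; rewrite -ltNge.
  apply: lt_le_trans h _; rewrite /order_stat -/s.
  by apply: (sorted_leq_nth le_trans lexx) => //; rewrite ?inE ?leq_addr.
congr (_ < _)%N; rewrite (permP (permEl (perm_sort _ _))) count_map.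
rewrite -size_filter cardE; congr size.
by rewrite [RHS]/enum_mem -enumT; apply: eq_filter.
Qed.

Lemma order_stat_le_shift x y j c : (j < k)%N -> (forall i, x i <= y i + c) ->
  order_stat x j <= order_stat y j + c.
Proof.
move=> jk xy; rewrite order_stat_le//.
have := lexx (order_stat y j); rewrite {1}order_stat_le// => /leq_trans; apply.
apply: subset_leq_card; apply/fintype.subsetP => i; rewrite !inE => h.
by rewrite (le_trans (xy i))// lerD2r.
Qed.

Lemma order_stat_affine x j a c : (j < k)%N -> 0 <= a ->
  order_stat (fun i => a * x i + c) j = a * order_stat x j + c.
Proof.
move=> jk a0; rewrite /order_stat.
have mono : {homo (fun r : R => a * r + c) : r s / r <= s}.
  by move=> r s rs; rewrite lerD2r ler_wpM2l.
have -> : sort <=%R (codom (fun i => a * x i + c)) =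
    [seq a * r + c | r <- sort <=%R (codom x)].
  apply: (sorted_eq le_trans le_anti).
  - exact: sort_le_sorted.
  - apply: (path.homo_sorted mono); exact: sort_le_sorted.
  rewrite perm_sort perm_sym.
  have -> : codom (fun i => a * x i + c) = map (fun r => a * r + c) (codom x).
    by rewrite !codomE -[RHS]map_comp.
  by apply: perm_map; rewrite perm_sort.
by rewrite (nth_map 0) ?size_order_stat.
Qed.

(** For 0 < a < 1 both ranks of the quantile are genuine positions, so that
    the default value of [nth] is never returned. Without this, translations
    would not commute with the quantile. *)
Lemma quantile_order_stat a : 0 < a < 1 -> exists j1 j2, [/\ (j1 < k)%N, (j2 < k)%N &
  forall x, quantile a x = (order_stat x j1 + order_stat x j2) / 2].
Proof.
move=> /andP[a0 a1].
have k0 : (0 : R) < k%:R by rewrite ltr0n.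
exists `|Num.ceil (k%:R * a)|%N.-1, `|Num.floor (k%:R * a + 1)|%N.-1; split=> //.
- have c1 : 0 < Num.ceil (k%:R * a) by rewrite ceil_gt0 mulr_gt0.
  have c2 : Num.ceil (k%:R * a) <= k%:Z.
    by rewrite ceil_le_int// ger_pMr// ltW.
  by move: c1 c2; case: (Num.ceil _) => // n _; rewrite lez_nat /= => nk; case: n nk.
- have f1 : 0 < Num.floor (k%:R * a + 1).
    by rewrite (@lt_le_trans _ _ 1%:Z)// floor_ge_int lerDr mulr_ge0// ltW.
  have f2 : Num.floor (k%:R * a + 1) < k%:Z + 1.
    by rewrite floor_lt_int// intrD ltrD2r gtr_pMr.
  by move: f1 f2; case: (Num.floor _) => // n; lia.
Qed.

Lemma quantile_lipschitz a x y : 0 < a < 1 ->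
  `|quantile a x - quantile a y| <= \sum_i `|x i - y i|.
Proof.
move=> /quantile_order_stat[j1 [j2 [j1k j2k H]]]; rewrite !H.
pose c := \sum_i `|x i - y i|.
have ci i : `|x i - y i| <= c by rewrite /c (bigD1 i)//= lerDl sumr_ge0.
have xy i : x i <= y i + c by have := ci i; rewrite ler_norml => /andP[_]; lra.
have yx i : y i <= x i + c by have := ci i; rewrite ler_norml => /andP[+ _]; lra.
have := order_stat_le_shift j1k xy; have := order_stat_le_shift j2k xy.
have := order_stat_le_shift j1k yx; have := order_stat_le_shift j2k yx.
rewrite -/c ler_norml; lra.
Qed.

Lemma quantile_affine a x t c : 0 < a < 1 -> 0 <= t ->
  quantile a (fun i => t * x i + c) = t * quantile a x + c.
Proof.
move=> /quantile_order_stat[j1 [j2 [j1k j2k H]]] t0; rewrite !H.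
by rewrite !order_stat_affine//; field.
Qed.

End Quantile.

(** * Component-wise quantiles in a Banach space *)

Section SchauderQuantile.
Context (R : realType) (X : completeNormedModType R) (d : nat -> X).
Hypothesis hd : unconditional_schauder_basis d.
Local Notation coef := (schauder_coef d).

(** The multiplied series converges and not just its partial sums are bounded,
    because the tails of the expansion of x are small uniformly in the
    multipliers. *)
Lemma multiplier_operator (K : R) : (forall v : X, multipliers_bounded d v (K * `|v|)) ->
  forall x (lam : nat -> R), (forall l, `|lam l| <= 1) ->
  exists2 z, series (fun l => (lam l * coef x l) *: d l) @ \oo --> z &
    `|z| <= K * `|x|.
Proof.
move=> HK x lam l1.
have : cvgn (series (fun l => (lam l * coef x l) *: d l)).
  apply/cauchy_cvgP/cauchy_seriesP => e e0.
  have [N HN] := schauder_tail hd x (divr_gt0 e0 (ltr0n R 2)).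
  exists ([set n | (N <= n)%N], [set: nat]); first by split; [exists N|exact: filterT].
  move=> [m n] /= [Nm _]; rewrite (le_lt_trans (HN _ _ _ l1 Nm))//.
  by rewrite ltr_pdivrMr// ltr_pMr// ltr1n.
move=> /cvg_ex[z zP]; exists z => //.
rewrite -(cvg_lim _ (cvg_norm zP))//.
apply: limr_le; first exact/cvgP/(cvg_norm zP).
by near=> n; exact: HK.
Unshelve. all: by end_near.
Qed.

Section FixedLevels.
Context (k : nat) (hk : (0 < k)%N) (alpha : nat -> R).
Hypothesis halpha : forall l, 0 < alpha l < 1.
Implicit Types x y : 'I_k -> X.
Local Notation q l x := (quantile (alpha l) (fun i => coef (x i) l)).
Local Notation qS := (schauder_quantile d alpha).

(** The difference of quantiles is bounded by the sum S of the absolute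
    displacements; distributing it proportionally to the displacements, with
    their signs, gives multipliers of absolute value at most 1. *)
Lemma quantile_difference (a : R) (x y : 'I_k -> R) : 0 < a < 1 ->
  exists mu : 'I_k -> R, (forall i, `|mu i| <= 1) /\
    quantile a x - quantile a y = \sum_i mu i * (x i - y i).
Proof.
move=> a01; set D := _ - _; pose S := \sum_i `|x i - y i|.
have DS : `|D| <= S by exact: quantile_lipschitz.
have S0 : 0 <= S by exact: le_trans DS.
(* When S = 0 the difference D vanishes too, and D / 0 = 0 is still a valid
   choice. *)
exists (fun i => D / S * Num.sg (x i - y i)); split.
  move=> i; rewrite normrM normr_sg.
  suff h : `|D / S| <= 1 by case: (_ != _); rewrite ?mulr1// mulr0.
  have [->|Sn0] := eqVneq S 0; first by rewrite invr0 mulr0 normr0.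
  by rewrite normrM normfV (ger0_norm S0) ler_pdivrMr ?mul1r// lt0r Sn0.
rewrite (eq_bigr (fun i => D / S * `|x i - y i|)); last first.
  by move=> i _; rewrite -(mulrA (D / S)) [in RHS]normrEsg.
rewrite -mulr_sumr -/S; have [S00|Sn0] := eqVneq S 0; last by rewrite divfK.
by move: DS; rewrite S00 mulr0 normr_le0 => /eqP.
Qed.

(** Coordinate by coordinate, the difference is spread over the k vectors [x i
    - y i] with multipliers bounded by 1; [z i] is the image of [x i - y i]
    under the resulting multiplier operator. *)
Lemma quantile_series_difference x y : exists2 z : 'I_k -> X,
  series (fun l => (q l x - q l y) *: d l) @ \oo --> \sum_i z i &
  forall K, (forall v : X, multipliers_bounded d v (K * `|v|)) ->
    forall i, `|z i| <= K * `|x i - y i|.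
Proof.
have /choice[mu muP] := fun l => quantile_difference
  (fun i => coef (x i) l) (fun i => coef (y i) l) (halpha l).
have [K0 _ HK0] := unconditional_constant hd.
have ex i : exists z : X, series (fun l => (mu l i * coef (x i - y i) l) *: d l)
     @ \oo --> z.
  have [|z] := multiplier_operator HK0 (x i - y i) (lam := fun l => mu l i).
    by move=> l; have [] := muP l.
  by exists z.
have [z zP] := choice ex; exists z; last first.
  move=> K HK i.
  have [|z' z'P] := multiplier_operator HK (x i - y i) (lam := fun l => mu l i).
    by move=> l; have [] := muP l.
  by rewrite (cvg_unique _ z'P (zP i)).
have -> : series (fun l => (q l x - q l y) *: d l) = (fun n =>
    \sum_i series (fun l => (mu l i * coef (x i - y i) l) *: d l) n).
  apply/funext => n; rewrite /series/= exchange_big/=; apply: eq_bigr => l _.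
  rewrite (muP l).2 scaler_suml; apply: eq_bigr => i _.
  by rewrite schauder_coefB.
exact: cvg_sum_seq.
Qed.

(** The quantile of the zero family is zero, so this is the previous lemma for
    [y = 0]. *)
Lemma schauder_quantile_cvg x :
  series (fun l => q l x *: d l) @ \oo --> qS x.
Proof.
have [z zP _] := quantile_series_difference x (fun=> 0).
suff E : series (fun l => q l x *: d l) =
    series (fun l => (q l x - q l (fun _ : 'I_k => 0 : X)) *: d l).
  by rewrite /schauder_quantile E; apply/cvgP/zP.
apply/funext => n; rewrite /series/=; apply: eq_bigr => l _; congr (_ *: _).
rewrite [X in _ - X](_ : _ = 0) ?subr0//.
(* The affine rule with factor 0 computes the quantile of a constant
   family. *)
have E : (fun _ : 'I_k => coef 0 l) = (fun _ : 'I_k => 0 * (0 : R) + 0).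
  by apply/funext => i; rewrite mul0r schauder_coef0// addr0.
by rewrite E (quantile_affine hk (fun=> 0) 0 (halpha l) (lexx 0)) mul0r addr0.
Qed.

Lemma schauder_quantile_lipschitz (K : R) :
  (forall v : X, multipliers_bounded d v (K * `|v|)) ->
  forall x y, `|qS x - qS y| <= K * \sum_i `|x i - y i|.
Proof.
move=> HK x y; have [z zP zK] := quantile_series_difference x y.
have -> : qS x - qS y = \sum_i z i.
  apply: (cvg_unique _ _ zP) => //.
  rewrite (_ : series _ = series (fun l => q l x *: d l) \- series (fun l => q l y *: d l)).
    by apply: cvgB; exact: schauder_quantile_cvg.
  apply/funext => n; rewrite /series/= -sumrB.
  by apply: eq_bigr => l _; rewrite scalerBl.
rewrite mulr_sumr (le_trans (ler_norm_sum _ _ _))// ler_sum// => i _.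
exact: zK.
Qed.

Lemma schauder_quantile_affine x t c : 0 <= t ->
  qS (fun i => t *: x i + c) = t *: qS x + c.
Proof.
move=> t0; have E := @schauder_quantile_cvg (fun i => t *: x i + c).
apply: (cvg_unique _ E) => //.
have -> : series (fun l => q l (fun i => t *: x i + c) *: d l) = (fun n =>
    t *: series (fun l => q l x *: d l) n +
    series (fun l => coef c l *: d l) n).
  apply/funext => n; rewrite /series/= scaler_sumr -big_split/=.
  apply: eq_bigr => l _; rewrite scalerA -scalerDl -quantile_affine//.
  by congr (quantile _ _ *: _); apply/funext => i; rewrite schauder_coef_lin.
apply: cvgD; last exact: schauder_coefP.
by apply: cvgZl_tmp; exact: schauder_quantile_cvg.
Qed.

End FixedLevels.

(** The finite combinations of basis vectors with rational coefficients are
    dense and countable. *)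
Lemma schauder_basis_separable : exists e : nat -> X,
  forall x (eps : R), 0 < eps -> exists j, `|x - e j| < eps.
Proof.
pose comb (s : seq rat) := \sum_(0 <= l < size s) (ratr s`_l : R) *: d l.
(* A sequence of rationals stands for the combination having it as its list of
   coefficients. *)
exists (fun j => if unpickle j is Some s then comb s else 0) => x eps e0.
have e2 : 0 < eps / 2 by rewrite divr_gt0.
have [N _ /(_ N (leqnn N)) HN] : \forall n \near \oo,
    `|x - series (fun l => coef x l *: d l) n| < eps / 2.
  by move/cvgrPdist_lt : (@schauder_coefP _ _ _ hd x); exact.
have /choice[r rP] l : exists r : rat,
    `|coef x l - ratr r| * `|d l| <= eps / 2 / N.+1%:R.
  pose dl := `|d l| + 1.
  have dl0 : 0 < dl by rewrite ltr_wpDl.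
  have t0 : 0 < eps / 2 / N.+1%:R / dl by rewrite !divr_gt0.
  have [r] := rat_in_itvoo (ltr_pwDr t0 (lexx (coef x l))).
  rewrite in_itv/= => /andP[h1 h2]; exists r.
  rewrite distrC gtr0_norm ?subr_gt0//.
  apply: (@le_trans _ _ (eps / 2 / N.+1%:R / dl * dl)); last by rewrite divfK// gt_eqF.
  apply: ler_pM => //; first by rewrite subr_ge0 ltW.
    by rewrite lerBlDl ltW.
  by rewrite lerDl.
exists (pickle (mkseq r N)); rewrite pickleK /comb size_mkseq.
set S := series _ N in HN.
have -> : x - \sum_(0 <= l < N) ratr (mkseq r N)`_l *: d l =
    (x - S) + \sum_(0 <= l < N) (coef x l - ratr (r l)) *: d l.
  rewrite -[RHS]addrA; congr (_ + _); rewrite /S /series/= -sumrN -sumrN -big_split/=.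
  rewrite !big_nat; apply: eq_bigr => l /andP[_ lN].
  by rewrite nth_mkseq// scalerBl addrA addNr add0r.
rewrite (le_lt_trans (ler_normD _ _))// [ltRHS]splitr ltr_leD//.
rewrite (le_trans (ler_norm_sum _ _ _))//.
apply: (@le_trans _ _ (\sum_(0 <= l < N) eps / 2 / N.+1%:R)).
  by apply: ler_sum => l _; rewrite normrZ.
rewrite sumr_const_nat subn0 -[leLHS]mulr_natr.
rewrite -[leLHS]mulrA ler_piMr ?ltW//.
by rewrite mulrC ltr_pdivrMr// mul1r ltr_nat.
Qed.

End SchauderQuantile.

(** * Means of bounded random variables *)

Section Expectation.
Context d (Omega : measurableType d) (R : realType) (P : probability Omega R).
Implicit Types F G : Omega -> R.

Definition bounded_measurable F :=
  measurable_fun [set: Omega] F /\ exists C, forall w, `|F w| <= C.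
Local Notation bm := bounded_measurable.
Local Notation "''E' F" := (\int[P]_w F w) (at level 10, F at level 8).

Lemma bounded_measurable_integrable F : bm F -> P.-integrable setT (EFin \o F).
Proof.
move=> [mF [C HC]]; apply: measurable_bounded_integrable => //.
  by rewrite (le_lt_trans (probability_le1 P measurableT))// ltry.
exists C; split; first exact: num_real.
by move=> M /ltW CM w _; rewrite /= (le_trans (HC w)).
Qed.

Lemma bounded_measurable_integral F : bm F -> (\int[P]_w (F w)%:E)%E = ('E F)%:E.
Proof.
move=> bF; rewrite /Rintegral fineK//; apply: integrable_fin_num => //.
exact: bounded_measurable_integrable.
Qed.

Lemma bounded_measurable_cst (c : R) : bm (fun=> c).
Proof. by split; [exact: measurable_cst|exists `|c|]. Qed.

Lemma bounded_measurableD F G : bm F -> bm G -> bm (fun w => F w + G w).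
Proof.
move=> [mF [C HC]] [mG [D HD]]; split; first exact: measurable_funD.
by exists (C + D) => w; rewrite (le_trans (ler_normD _ _))// lerD.
Qed.

Lemma bounded_measurableM F G : bm F -> bm G -> bm (fun w => F w * G w).
Proof.
move=> [mF [C HC]] [mG [D HD]]; split; first exact: measurable_funM.
by exists (C * D) => w; rewrite normrM ler_pM.
Qed.

Lemma bounded_measurableB F G : bm F -> bm G -> bm (fun w => F w - G w).
Proof.
move=> [mF [C HC]] [mG [D HD]]; split; first exact: measurable_funB.
by exists (C + D) => w; rewrite (le_trans (ler_normB _ _))// lerD.
Qed.

Lemma bounded_measurable_norm F : bm F -> bm (fun w => `|F w|).
Proof.
move=> [mF [C HC]]; split; first exact: measurableT_comp.
by exists C => w; rewrite normr_id.
Qed.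

Lemma bounded_measurable_sum (I : Type) (r : seq I) (F : I -> Omega -> R) :
  (forall i, bm (F i)) -> bm (fun w => \sum_(i <- r) F i w).
Proof.
move=> bF; elim: r => [|i r IH].
  under [X in bm X]eq_fun do rewrite big_nil; exact: bounded_measurable_cst.
by under [X in bm X]eq_fun do rewrite big_cons; exact: bounded_measurableD.
Qed.

Lemma bounded_measurable_prod (I : Type) (r : seq I) (Q : pred I) (F : I -> Omega -> R) :
  (forall i, bm (F i)) -> bm (fun w => \prod_(i <- r | Q i) F i w).
Proof.
move=> bF; elim: r => [|i r IH].
  under [X in bm X]eq_fun do rewrite big_nil; exact: bounded_measurable_cst.
under [X in bm X]eq_fun do rewrite big_cons.
by case: (Q i) => //; exact: bounded_measurableM.
Qed.

Lemma bounded_measurable_indic (A : set Omega) : measurable A -> bm (\1_A : Omega -> R).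
Proof.
move=> mA; split; first exact: measurable_indic.
by exists 1 => w; rewrite indicE normr_nat lern1 leq_b1.
Qed.

Lemma mean_indic (A : set Omega) : measurable A -> 'E (\1_A : Omega -> R) = fine (P A).
Proof.
by move=> mA; rewrite /Rintegral integral_indic// setIT.
Qed.

Lemma mean_cst (c : R) : 'E (fun=> c) = c.
Proof. by rewrite Rintegral_cst//= probability_setT mulr1. Qed.

Lemma meanD F G : bm F -> bm G -> 'E (fun w => F w + G w) = 'E F + 'E G.
Proof. by move=> bF bG; apply: RintegralD => //; exact: bounded_measurable_integrable. Qed.

Lemma meanB F G : bm F -> bm G -> 'E (fun w => F w - G w) = 'E F - 'E G.
Proof. by move=> bF bG; apply: RintegralB => //; exact: bounded_measurable_integrable. Qed.

Lemma meanZ F (c : R) : bm F -> 'E (fun w => c * F w) = c * 'E F.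
Proof. by move=> bF; apply: RintegralZl => //; exact: bounded_measurable_integrable. Qed.

Lemma mean_sum (I : Type) (r : seq I) (F : I -> Omega -> R) :
  (forall i, bm (F i)) -> 'E (fun w => \sum_(i <- r) F i w) = \sum_(i <- r) 'E (F i).
Proof.
move=> bF; elim: r => [|i r IH].
  by under eq_Rintegral do rewrite big_nil; rewrite big_nil mean_cst.
under eq_Rintegral do rewrite big_cons.
by rewrite meanD// ?big_cons ?IH//; exact: bounded_measurable_sum.
Qed.

Lemma le_mean F G : bm F -> bm G -> (forall w, F w <= G w) -> 'E F <= 'E G.
Proof. by move=> bF bG FG; apply: le_Rintegral => //; exact: bounded_measurable_integrable. Qed.

Lemma mean_ge0 F : (forall w, 0 <= F w) -> 0 <= 'E F.
Proof. by move=> F0; apply: Rintegral_ge0. Qed.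

Lemma le_mean_dist F G H : bm F -> bm G -> bm H ->
  (forall w, `|F w - G w| <= H w) -> `|'E F - 'E G| <= 'E H.
Proof.
move=> bF bG bH FGH; rewrite -meanB//.
apply: le_trans (le_normr_Rintegral _ _) _ => //.
  exact/bounded_measurable_integrable/bounded_measurableB.
apply: le_mean => //; exact/bounded_measurable_norm/bounded_measurableB.
Qed.

Lemma le_mean_dist_cst F G (c : R) : bm F -> bm G ->
  (forall w, `|F w - G w| <= c) -> `|'E F - 'E G| <= c.
Proof.
move=> bF bG FG; rewrite -[leRHS]mean_cst.
by apply: le_mean_dist => //; exact: bounded_measurable_cst.
Qed.

Lemma mean_dominated_cvg (F : nat -> Omega -> R) G (C : R) :
  (forall n, measurable_fun setT (F n)) -> (forall n w, `|F n w| <= C) ->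
  (forall w, F ^~ w @ \oo --> G w) -> bm G ->
  'E (F n) @[n --> \oo] --> 'E G.
Proof.
move=> mF FC FG bG.
have bF n : bm (F n) by split => //; exists C.
have [_ _] := @dominated_convergence _ _ _ P setT measurableT
  (fun n w => (F n w)%:E) (fun w => (G w)%:E) (fun=> C%:E)
  (fun n => (measurable_EFinP _ _).2 (mF n)) ((measurable_EFinP _ _).2 bG.1)
  (aeW _ (fun w _ => (fine_cvgP (fun n => (F n w)%:E) (G w)).2 (conj (nearW _ (fun=> isT)) (FG w))))
  (bounded_measurable_integrable (bounded_measurable_cst C))
  (aeW _ (fun w n _ => FC n w)).
rewrite bounded_measurable_integral//.
by move=> /fine_cvgP[_].
Qed.

End Expectation.

(** * Independence: from events to functions, from observations to blocks *)

Section Independence.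
Context d (Omega : measurableType d) (R : realType) (P : probability Omega R).

Definition set_coord (I : eqType) (F : Type) (f : I -> F) (i : I) (a : F) : I -> F :=
  fun j => if j == i then a else f j.

(** Entries are upgraded from [A] to [B] one at a time, by induction on the
    set of those that may lie outside [A]. It serves twice: from a pi-system
    to its sigma-algebra, and from indicators to functions. *)
Lemma coordinatewise_extension (I : finType) (F : Type) (A B : F -> Prop)
    (Q : (I -> F) -> Prop) : (forall a, A a -> B a) ->
  (forall f i, (forall j, B (f j)) -> (forall a, A a -> Q (set_coord f i a)) ->
     Q f) ->
  (forall f, (forall i, A (f i)) -> Q f) -> forall f, (forall i, B (f i)) -> Q f.
Proof.
move=> AB step QA.
suff H (s : seq I) : forall f, (forall i, B (f i)) ->
    (forall i, i \notin s -> A (f i)) -> Q f.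
  by move=> f Bf; apply: (H (enum I)) => // i; rewrite mem_enum.
elim: s => [|i s IH] f Bf Af; first by apply: QA => i; exact: Af.
apply: (step f i) => // a Aa; apply: IH => [j|j js].
  by rewrite /set_coord; case: eqP => // _; exact: AB.
rewrite /set_coord; case: eqP => // /eqP ji.
by apply: Af; rewrite inE negb_or ji.
Qed.

Lemma prod_set_coord (I : finType) (V : comNzSemiRingType) (F : Type)
    (f : I -> F) (i : I) a (h : I -> F -> V) :
  \prod_j h j (set_coord f i a j) = h i a * \prod_(j | j != i) h j (f j).
Proof.
rewrite (bigD1 i)//= {1}/set_coord eqxx; congr (_ * _).
by apply: eq_bigr => j ji; rewrite /set_coord (negbTE ji).
Qed.

(** With all coordinates but the i-th fixed, both sides of the product formula
    are finite measures in the i-th set; two finite measures that agree on a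
    generating pi-system are equal. *)
Lemma pi_system_independence (dT : measure_display) (T : measurableType dT)
    (G : set (set T)) (I : finType) (V : I -> Omega -> T) :
  measurable = <<s G>> -> setI_closed G -> G setT ->
  (forall i, measurable_fun setT (V i)) ->
  (forall A : I -> set T, (forall i, G (A i)) ->
    fine (P (\bigcap_i (V i @^-1` A i))) = \prod_i fine (P (V i @^-1` A i))) ->
  forall A : I -> set T, (forall i, measurable (A i)) ->
    fine (P (\bigcap_i (V i @^-1` A i))) = \prod_i fine (P (V i @^-1` A i)).
Proof.
move=> mG GI GT mV HG.
have mVA i A : measurable A -> measurable (V i @^-1` A).
  by move=> mA; rewrite -[_ @^-1` _]setTI; exact: mV.
pose Q (A : I -> set T) :=
  fine (P (\bigcap_i (V i @^-1` A i))) = \prod_i fine (P (V i @^-1` A i)).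
apply: (@coordinatewise_extension _ _ G measurable Q) => //.
  by move=> a Ga; rewrite mG; exact: sub_sigma_algebra.
move=> f i mf Hf.
pose E := \bigcap_(j in [set j | j != i]) (V j @^-1` f j).
have mE : measurable E.
  apply: fin_bigcap_measurable; first exact: finite_finset.
  by move=> j _; exact: mVA.
have capE a : \bigcap_j (V j @^-1` set_coord f i a j) = V i @^-1` a `&` E.
  apply/seteqP; split => w.
    move=> H; split; first by have := H i Logic.I; rewrite /set_coord eqxx.
    by move=> j /= ji; have := H j Logic.I; rewrite /set_coord (negbTE ji).
  move=> [wa wE] j _; rewrite /set_coord; case: eqP => [->//|/eqP ji].
  exact: wE.
pose c := \prod_(j | j != i) fine (P (V j @^-1` f j)).
have c0 : 0 <= c by apply: prodr_ge0 => j _; exact: fine_ge0.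
(* E is the event described by the other coordinates. The whole space as i-th
   set shows that its probability is the product c, after which the formula
   says that E is independent of the i-th coordinate. *)
have QE a : Q (set_coord f i a) <-> fine (P (V i @^-1` a `&` E)) =
    fine (P (V i @^-1` a)) * c.
  by rewrite /Q capE (prod_set_coord f i a (fun j B => fine (P (V j @^-1` B)))).
have PE : fine (P E) = c.
  by have /QE := Hf _ GT; rewrite preimage_setT setTI probability_setT mul1r.
have updf : set_coord f i (f i) = f.
  by apply/funext => j; rewrite /set_coord; case: eqP => // ->.
rewrite -updf; apply/QE.
pose m1_ : {measure set T -> \bar R} := pushforward (mrestr P mE) (V i).
pose m2_ : {measure set T -> \bar R} := mscale (NngNum c0) (pushforward P (V i)).
pose m1 := m1_ (mV i); pose m2 := m2_ (mV i).
have m12 A : measurable A -> m1 A = m2 A <->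
   fine (P (V i @^-1` A `&` E)) = fine (P (V i @^-1` A)) * c.
  move=> mA; have -> : m1 A = P (V i @^-1` A `&` E) by [].
  have -> : m2 A = (c%:E * P (V i @^-1` A))%E by [].
  have f1 : P (V i @^-1` A) \is a fin_num by apply: fin_num_measure; exact: mVA.
  have f2 : P (V i @^-1` A `&` E) \is a fin_num.
    by apply: fin_num_measure; apply: measurableI => //; exact: mVA.
  rewrite -[X in (X = _)%E <-> _]fineK// -[X in (_ = _ * X)%E <-> _]fineK//.
  by rewrite -EFinM mulrC; split=> [[]|->].
apply/m12 => //; apply: (measure_unique G (fun=> setT)) => //.
- by rewrite bigcup_const//; exists 0%N.
- by move=> A GA; apply/m12; [rewrite mG; exact: sub_sigma_algebra|exact/QE/Hf].
- move=> _; rewrite /m1/= /pushforward /mrestr.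
  by rewrite preimage_setT setTI (le_lt_trans (probability_le1 _ _)) ?ltry.
Qed.

Local Notation bm := (bounded_measurable).
Local Notation "''E' F" := (\int[P]_w F w) (at level 10, F at level 8).

(** The sum counts the levels j/N below t, so it is the integer part of
    Nt. *)
Lemma staircase_approx (t : R) (N : nat) : 0 <= t <= 1 -> (0 < N)%N ->
  `|N%:R^-1 * (\sum_(j < N) (j.+1%:R <= N%:R * t)%R%:R) - t| <= N%:R^-1.
Proof.
move=> /andP[t0 t1] N0.
have N0' : (0 : R) < N%:R by rewrite ltr0n.
pose m := Num.truncn (N%:R * t).
have mt : m%:R <= N%:R * t by rewrite truncn_le ?mulr_ge0.
have tm : N%:R * t < m.+1%:R by exact: truncnS_gt.
have mN : (m <= N)%N.
  by rewrite -(ler_nat R) (le_trans mt)// ler_piMr// ltW.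
have -> : \sum_(j < N) (j.+1%:R <= N%:R * t)%R%:R = m%:R :> R.
  rewrite -natr_sum; congr (_%:R).
  rewrite (eq_bigr (fun j : 'I_N => (j < m)%N : nat)); last first.
    move=> j _; congr (nat_of_bool _).
    by rewrite -truncn_ge_nat// mulr_ge0.
  rewrite -big_mkcond/= -(big_ord_widen N (fun=> 1%N))//.
  by rewrite sum1_card card_ord.
have -> : N%:R^-1 * m%:R - t = N%:R^-1 * (m%:R - N%:R * t).
  by rewrite mulrBr mulKf// gt_eqF.
rewrite normrM gtr0_norm ?invr_gt0// ler_piMr ?invr_ge0 ?(ltW N0')//.
rewrite ler_norml; move: tm; rewrite -[m.+1]addn1 natrD; lra.
Qed.

(** With all functions but the i-th fixed, both sides are linear in the i-th
    function. A function with values in the unit interval is a uniform limit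
    of averages of indicators of its superlevel sets, so that the formula
    passes from indicators to functions. *)
Lemma mean_prod (dT : measure_display) (T : measurableType dT)
    (I : finType) (V : I -> Omega -> T) :
  (forall i, measurable_fun setT (V i)) ->
  (forall A : I -> set T, (forall i, measurable (A i)) ->
    fine (P (\bigcap_i (V i @^-1` A i))) = \prod_i fine (P (V i @^-1` A i))) ->
  forall phi : I -> T -> R,
    (forall i, measurable_fun setT (phi i) /\ forall x, 0 <= phi i x <= 1) ->
    'E (fun w => \prod_i phi i (V i w)) = \prod_i 'E (fun w => phi i (V i w)).
Proof.
move=> mV HA.
pose A := [set f : T -> R | exists2 B, measurable B & f = \1_B].
pose B := [set f : T -> R | measurable_fun setT f /\ forall x, 0 <= f x <= 1].
have AB f : A f -> B f.
  move=> [C mC ->]; split; first exact: measurable_indic.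
  by move=> x; rewrite indicE ler0n lern1 leq_b1.
have bmV i f : B f -> bm (fun w => f (V i w)).
  move=> [mf f01]; split; first exact: measurableT_comp.
  by exists 1 => w; have /andP[? ?] := f01 (V i w); rewrite ger0_norm.
apply: (coordinatewise_extension AB); last first.
  move=> f Af; have /choice[C HC] i : exists C, measurable C /\ f i = \1_C.
    by have [C mC fC] := Af i; exists C.
  have mC i : measurable (C i) by have [] := HC i.
  have fC i : f i = \1_(C i) by have [] := HC i.
  have mVC i : measurable (V i @^-1` C i).
    by rewrite -[_ @^-1` _]setTI; exact: mV.
  have -> : (fun w => \prod_i f i (V i w)) = \1_(\bigcap_i (V i @^-1` C i)).
    apply/funext => w; rewrite indicE.
    under eq_bigr do rewrite fC indicE.
    have [/asboolP H|/asboolP H] := boolP `[< forall i, C i (V i w) >].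
      rewrite mem_set; last by move=> i _; exact: H.
      by rewrite big1// => i _; rewrite mem_set.
    rewrite memNset; last by move=> H'; apply: H => i; exact: H'.
    move: H => /existsNP[i Hi]; rewrite (bigD1 i)//= memNset ?mul0r//.
  rewrite mean_indic; last first.
    by apply: fin_bigcap_measurable => //; exact: finite_finset.
  rewrite HA//; apply: eq_bigr => i _.
  rewrite -mean_indic//; congr Rintegral; apply/funext => w.
  by rewrite fC.
move=> f i Bf Hf.
pose H w := \prod_(j | j != i) f j (V j w).
pose c := \prod_(j | j != i) 'E (fun w => f j (V j w)).
have bH : bm H by apply: bounded_measurable_prod => j; exact: bmV.
have H01 w : 0 <= H w <= 1.
  rewrite prodr_ge0 => [|j _]; last by have [_ /(_ (V j w))/andP[]] := Bf j.
  by apply: prodr_ile1 => j _; have [_] := Bf j; exact.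
have c01 : 0 <= c <= 1.
  rewrite prodr_ge0 => [|j _]; last first.
    by apply: mean_ge0 => w; have [_ /(_ (V j w))/andP[]] := Bf j.
  apply: prodr_ile1 => j _; rewrite mean_ge0 => [|w]; last first.
    by have [_ /(_ (V j w))/andP[]] := Bf j.
  rewrite -(mean_cst P 1) le_mean//.
  - exact: bmV.
  - exact: bounded_measurable_cst.
  - by move=> w; have [_ /(_ (V j w))/andP[]] := Bf j.
have indic (C : set T) : measurable C ->
    'E (fun w => \1_C (V i w) * H w) = 'E (fun w => \1_C (V i w)) * c.
  move=> mC; have := Hf (\1_C) (ex_intro2 _ _ C mC erefl).
  rewrite (prod_set_coord f i _ (fun j g => 'E (fun w => g (V j w)))) => <-.
  congr Rintegral; apply/funext => w.
  by rewrite (prod_set_coord f i _ (fun j g => g (V j w))).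
suff : 'E (fun w => f i (V i w) * H w) = 'E (fun w => f i (V i w)) * c.
  move=> Efi; rewrite [RHS](bigD1 i)//= -/c -Efi; congr Rintegral; apply/funext => w.
  by rewrite (bigD1 i).
have [mfi fi01] := Bf i.
pose C (N : nat) (j : 'I_N) := [set x | j.+1%:R <= N%:R * f i x].
have mC N (j : 'I_N) : measurable (C N j).
  rewrite /C -[X in measurable X]setTI.
  by apply: measurable_fun_le => //; exact: measurable_funM.
pose S N x : R := N%:R^-1 * \sum_(j < N) \1_(C N j) x.
have bC N j : bm (fun w => \1_(C N j) (V i w) : R).
  by apply: bmV; apply: AB; exists (C N j).
have bS N : bm (fun w => S N (V i w)).
  apply: bounded_measurableM; first exact: bounded_measurable_cst.
  exact: bounded_measurable_sum.
have SE N : 'E (fun w => S N (V i w) * H w) = 'E (fun w => S N (V i w)) * c.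
  rewrite /S.
  under eq_Rintegral do rewrite -mulrA mulr_suml.
  rewrite !meanZ ?mean_sum//.
  - by rewrite -mulrA; congr (_ * _); rewrite mulr_suml; apply: eq_bigr => j _;
      exact: indic.
  - by move=> j; exact: bounded_measurableM.
  - exact: bounded_measurable_sum.
  - by apply: bounded_measurable_sum => j; exact: bounded_measurableM.
have Sle N w : (0 < N)%N -> `|S N (V i w) - f i (V i w)| <= N%:R^-1.
  move=> N0; rewrite /S; under eq_bigr do rewrite indicE.
  have E j : (V i w \in C N j) = (j.+1%:R <= N%:R * f i (V i w)).
    by apply/idP/idP; rewrite inE.
  by under eq_bigr do rewrite E; exact: staircase_approx.
apply/eqP; rewrite -subr_eq0 -normr_le0; apply/ler_addgt0Pr => e e0.
rewrite add0r.
(* The staircase replaces the i-th function in both means, at a cost of 1/N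
   each. *)
have [N /andP[N0 Ne]] : exists N : nat, ((0 < N)%N && (N%:R^-1 * 2 <= e)).
  exists (Num.truncn (2 / e)).+1; rewrite ltn0Sn/= mulrC ler_pdivrMr//.
  by rewrite mulrC -ler_pdivrMr// ltW// truncnS_gt.
have -> : 'E (fun w => f i (V i w) * H w) - 'E (fun w => f i (V i w)) * c =
  ('E (fun w => f i (V i w) * H w) - 'E (fun w => S N (V i w) * H w)) +
  ('E (fun w => S N (V i w)) - 'E (fun w => f i (V i w))) * c.
  by rewrite SE mulrBl addrA subrK.
apply: le_trans Ne; rewrite mulr_natr mulr2n (le_trans (ler_normD _ _))// lerD//.
  apply: le_mean_dist_cst; try (by apply: bounded_measurableM => //; exact: bmV).
  move=> w; rewrite -mulrBl normrM -[leRHS]mulr1 ler_pM//.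
    by rewrite distrC Sle.
  by have /andP[? ?] := H01 w; rewrite ger0_norm.
rewrite normrM -[leRHS]mulr1 ler_pM//.
  apply: le_mean_dist_cst => //; first exact: bmV.
  by move=> w; rewrite Sle.
by have /andP[? ?] := c01; rewrite ger0_norm.
Qed.

End Independence.

Section Laws.
Context (R : realType) (dT : measure_display) (T : measurableType dT)
  (d1 : measure_display) (O1 : measurableType d1) (P1 : probability O1 R)
  (Z1 : O1 -> T)
  (d2 : measure_display) (O2 : measurableType d2) (P2 : probability O2 R)
  (Z2 : O2 -> T).
Hypotheses (mZ1 : measurable_fun setT Z1) (mZ2 : measurable_fun setT Z2).

Lemma same_law_mean (phi : T -> R) :
  same_law P1 Z1 P2 Z2 -> bounded_measurable phi ->
  \int[P1]_w phi (Z1 w) = \int[P2]_w phi (Z2 w).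
Proof.
move=> H [mphi [C HC]]; congr fine.
have mE : measurable_fun setT (EFin \o phi) by exact/measurable_EFinP.
have bm1 : bounded_measurable (phi \o Z1).
  by split; [exact: measurableT_comp|exists C => w; exact: HC].
have bm2 : bounded_measurable (phi \o Z2).
  by split; [exact: measurableT_comp|exists C => w; exact: HC].
have := integral_pushforward mZ1 mE (D := setT) (mu := P1).
rewrite preimage_setT => /(_ (bounded_measurable_integrable _ bm1) measurableT) <-.
have := integral_pushforward mZ2 mE (D := setT) (mu := P2).
rewrite preimage_setT => /(_ (bounded_measurable_integrable _ bm2) measurableT) <-.
by apply: eq_measure_integral => A mA _; exact: H.
Qed.

Lemma same_law_pi_system (G : set (set T)) :
  measurable = <<s G>> -> setI_closed G -> G setT ->
  (forall A, G A -> P1 (Z1 @^-1` A) = P2 (Z2 @^-1` A)) -> same_law P1 Z1 P2 Z2.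
Proof.
move=> mG GI GT H A mA.
pose m1_ : {measure set T -> \bar R} := pushforward P1 Z1.
pose m2_ : {measure set T -> \bar R} := pushforward P2 Z2.
apply: (measure_unique G (fun=> setT) mG GI _ _ (m1_ mZ1) (m2_ mZ2)) => //.
- by rewrite bigcup_const//; exists 0%N.
- move=> _; rewrite /m1_/= /pushforward preimage_setT.
  by rewrite (le_lt_trans (probability_le1 _ _)) ?ltry.
Qed.

End Laws.

Section Tuples.
Context (d : measure_display) (E : measurableType d) (m : nat).

(** The pi-system of rectangles generates the product sigma-algebra on tuples.
    Joint laws of observations are explicit on it. *)
Definition rectangles : set (set (m.-tuple E)) :=
  [set B | exists C : 'I_m -> set E, (forall j, measurable (C j)) /\
    B = [set t | forall j, C j (tnth t j)]].

Lemma measurable_rectangles : measurable = <<s rectangles>>.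
Proof.
apply/seteqP; split => B.
  move: B; apply: smallest_sub; first exact: smallest_sigma_algebra.
  rewrite -bigcup_seq => A [i _ [C mC <-]]; apply: sub_sigma_algebra.
  exists (fun j => if j == i then C else setT); split.
    by move=> j; case: (j == i).
  apply/seteqP; split => t /=.
    by move=> [_ Ct] j; case: eqP => // ->.
  by move=> H; split => //; have := H i; rewrite eqxx.
apply: smallest_sub; first exact: sigma_algebra_measurable.
move=> _ [C [mC ->]].
rewrite [X in measurable X](_ : _ = \bigcap_j ((@tnth m E)^~ j @^-1` C j)).
  apply: fin_bigcap_measurable; first exact: finite_finset.
  by move=> j _; rewrite -[_ @^-1` _]setTI; exact: measurable_tnth.
by apply/seteqP; split => t H j; [move=> _; exact: H|exact: (H j Logic.I)].
Qed.

Lemma rectanglesI : setI_closed rectangles.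
Proof.
move=> _ _ [C [mC ->]] [D [mD ->]].
exists (fun j => C j `&` D j); split; first by move=> j; exact: measurableI.
by apply/seteqP; split => t /= => [[h1 h2] j|h]; [split|split=> j; have [] := h j].
Qed.

Lemma rectanglesT : rectangles setT.
Proof. by exists (fun=> setT); split => //; apply/seteqP; split. Qed.

End Tuples.

Section Independence.
Context (R : realType) (dO : measure_display) (Omega : measurableType dO)
  (P : probability Omega R) (dT : measure_display) (T : measurableType dT).

Lemma mutually_independent_family (K : choiceType) (Z : K -> Omega -> T)
    (I : finType) (s : I -> K) (A : I -> set T) :
  mutually_independent P Z -> (forall i, measurable_fun setT (Z i)) ->
  injective s -> (forall i, measurable (A i)) ->
  fine (P (\bigcap_i (Z (s i) @^-1` A i))) = \prod_i fine (P (Z (s i) @^-1` A i)).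
Proof.
move=> HZ mZ sI mA.
(* Independence of the family Z is about sets indexed by K, so the sets A are
   carried over along the injection s. *)
pose A' n := if [pick i | s i == n] is Some i then A i else setT.
have A'E i : A' (s i) = A i.
  rewrite /A'; case: pickP => [j /eqP/sI -> //|/(_ i)].
  by rewrite eqxx.
have mA' n : measurable (A' n) by rewrite /A'; case: pickP.
have := HZ [fset s i | i in I]%fset A' mA'.
have -> : \bigcap_(i in [set` [fset s i | i in I]%fset]) (Z i @^-1` A' i) =
    \bigcap_i (Z (s i) @^-1` A i).
  apply/seteqP; split => w H i.
    by move=> _; rewrite -A'E; apply: H; apply/imfsetP; exists i.
  by move=> /imfsetP[j _ ->]; rewrite /preimage/= A'E; exact: H.
move=> ->; rewrite big_imfset/=; last by move=> i j _ _; exact: sI.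
have -> : (\prod_(i <- enum_finmem (mem I)) P (Z (s i) @^-1` A' (s i)))%E =
   (\prod_i (fine (P (Z (s i) @^-1` A i)))%:E)%E.
  rewrite big_enum_cond/=; apply: eq_big => i //.
  move=> _; rewrite A'E fineK//; apply: fin_num_measure.
  by rewrite -[_ @^-1` _]setTI; exact: mZ.
by rewrite prodEFin.
Qed.

End Independence.

Section Blocks.
Context (R : realType) (dO : measure_display) (Omega : measurableType dO)
  (P : probability Omega R) (dE : measure_display) (E : measurableType dE)
  (xi : nat -> Omega -> E).
Hypothesis hxi : iid P xi.

Local Notation sample s := (fun w => [tuple xi (s j) w | j < _]).

Lemma measurable_sample m (s : 'I_m -> nat) : measurable_fun setT (sample s).
Proof.
apply/measurable_fun_tnthP => j.
rewrite (_ : _ \o _ = xi (s j)); first by have [] := hxi.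
by apply/funext => w /=; rewrite tnth_mktuple.
Qed.

Lemma sample_rectangle m (s : 'I_m -> nat) (C : 'I_m -> set E) :
  sample s @^-1` [set t | forall j, C j (tnth t j)] =
  \bigcap_j (xi (s j) @^-1` C j).
Proof.
apply/seteqP; split => w /= H j.
  by move=> _; have := H j; rewrite tnth_mktuple.
by rewrite tnth_mktuple; exact: H.
Qed.

Lemma prob_rectangles (I : finType) (s : I -> nat) (C : I -> set E) :
  injective s -> (forall j, measurable (C j)) ->
  fine (P (\bigcap_j (xi (s j) @^-1` C j))) = \prod_j fine (P (xi 0%N @^-1` C j)).
Proof.
have [mxi ixi sxi] := hxi.
move=> sI mC; rewrite (mutually_independent_family ixi)//.
by apply: eq_bigr => j _; congr fine; exact: sxi.
Qed.

Lemma sample_law m (s1 s2 : 'I_m -> nat) : injective s1 -> injective s2 ->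
  same_law P (sample s1) P (sample s2).
Proof.
move=> s1I s2I; apply: (same_law_pi_system _ _ (@measurable_rectangles _ E m)).
- exact: measurable_sample.
- exact: measurable_sample.
- exact: rectanglesI.
- exact: rectanglesT.
move=> _ [C [mC ->]]; rewrite !sample_rectangle.
have fP (s : 'I_m -> nat) : P (\bigcap_j (xi (s j) @^-1` C j)) \is a fin_num.
  apply: fin_num_measure; apply: fin_bigcap_measurable; first exact: finite_finset.
  by move=> j _; rewrite -[_ @^-1` _]setTI; have [+ _ _] := hxi; apply.
by rewrite -[LHS]fineK// -[RHS]fineK// !prob_rectangles.
Qed.

(** On rectangles, the independence of disjoint blocks is that of the single
    observations. [pi_system_independence] extends it to all events and
    [mean_prod] to functions; since the observations are identically
    distributed, every block has the law of the first m observations. *)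
Lemma mean_blocks (k m : nat) (b : 'I_k -> 'I_m -> nat)
    (phi : 'I_k -> m.-tuple E -> R) :
  injective (fun p : 'I_k * 'I_m => b p.1 p.2) ->
  (forall i, measurable_fun setT (phi i) /\ forall x, 0 <= phi i x <= 1) ->
  \int[P]_w (\prod_i phi i [tuple xi (b i j) w | j < m]) =
  \prod_i \int[P]_w phi i [tuple xi j w | j < m].
Proof.
move=> bI Hphi.
have bIi i : injective (b i).
  by move=> j j' bjj'; have /(_ (i, j) (i, j') bjj')[] := bI.
rewrite (@mean_prod _ _ _ P _ _ _ (fun i => sample (b i)))//.
- apply: eq_bigr => i _.
  apply: (same_law_mean (Z1 := sample (b i)) (Z2 := sample (@nat_of_ord m))).
  + exact: measurable_sample.
  + exact: measurable_sample.
  + by apply: sample_law => //; exact: ord_inj.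
  + have [mp p01] := Hphi i; split => //; exists 1 => x.
    by have /andP[? ?] := p01 x; rewrite ger0_norm.
- by move=> i; exact: measurable_sample.
apply: (pi_system_independence (@measurable_rectangles _ E m)).
- exact: rectanglesI.
- exact: rectanglesT.
- by move=> i; exact: measurable_sample.
move=> A /choice[C HC].
have -> : \bigcap_i (sample (b i) @^-1` A i) =
    \bigcap_p (xi (b p.1 p.2) @^-1` C p.1 p.2).
  have AE i : A i = [set t | forall j, C i j (tnth t j)] by have [] := HC i.
  apply/seteqP; split => w H.
    move=> [i j] _; have := H i Logic.I.
    by rewrite AE sample_rectangle; exact.
  move=> i _; rewrite AE sample_rectangle => j _.
  exact: (H (i, j)).
rewrite (@prob_rectangles _ (fun p => b p.1 p.2) (fun p => C p.1 p.2))//; last first.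
  by move=> [i j]; have [] := HC i.
rewrite -(pair_bigA _ (fun i j => fine (P (xi 0%N @^-1` C i j))))/=.
apply: eq_bigr => i _; have [mC ->] := HC i.
by rewrite sample_rectangle prob_rectangles.
Qed.

End Blocks.

(** * Random vectors in a separable space *)

Section RandomElements.
Context (R : realType) (X : completeNormedModType R).

Lemma open_borel (U : set X) : open U -> measurable (U : set (borel X)).
Proof. by move=> oU; exact: sub_sigma_algebra. Qed.

Lemma continuous_borel_measurable (Y : completeNormedModType R) (f : X -> Y) :
  continuous f -> measurable_fun setT (f : borel X -> borel Y).
Proof.
move=> cf.
apply: (@measurability _ _ _ _ setT (f : borel X -> borel Y) (@open Y) erefl).
move=> _ [U oU <-]; rewrite setTI; apply: open_borel.
by apply: open_comp => // x _; exact: cf.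
Qed.

Lemma continuous_real_measurable (f : X -> R) :
  continuous f -> measurable_fun setT (f : borel X -> R).
Proof.
move=> cf; apply: (measurability _ (RGenOInfty.measurableE R)).
move=> _ [_ [r ->] <-]; rewrite setTI; apply: open_borel.
by apply: open_comp => [x _|]; [exact: cf|exact: interval_open].
Qed.

Lemma lipschitz_uniform (k : nat) (K eps : R) : 0 < eps ->
  exists2 r : R, 0 < r & forall x y : 'I_k -> X,
    (forall i, `|x i - y i| < r) -> K * \sum_i `|x i - y i| < eps.
Proof.
move=> e0; pose K' := `|K| * k%:R + 1.
have K'0 : 0 < K' by rewrite ltr_wpDl// mulr_ge0.
exists (eps / K'); first by rewrite divr_gt0.
move=> x y xy; apply: (@le_lt_trans _ _ (`|K| * (k%:R * (eps / K')))).
  apply: (@le_trans _ _ (`|K| * \sum_i `|x i - y i|)).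
    by rewrite ler_wpM2r ?ler_norm// sumr_ge0.
  rewrite ler_wpM2l// mulr_natl -[X in _ *+ X]card_ord -sumr_const.
  by apply: ler_sum => i _; exact: ltW.
rewrite [ltLHS](_ : _ = eps * (`|K| * k%:R) / K'); last by ring.
by rewrite ltr_pdivrMr// ltr_pM2l// ltrDl.
Qed.

Section Vectors.
Variable (e : nat -> X).
Hypothesis he : forall x (eps : R), 0 < eps -> exists j, `|x - e j| < eps.
Context (d : measure_display) (Omega : measurableType d) (k : nat).
Variable (V : 'I_k -> Omega -> X).
Hypothesis hV : forall i, random_element (V i).

(** An open set of X^k is a countable union of products of balls centred in
    the dense sequence, so that the joint measurability of the vector follows
    from that of its components. Openness is spelled out by uniform
    neighbourhoods in the k components. *)
Lemma random_vector_open_measurable (U : set ('I_k -> X)) :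
  (forall x, U x -> exists2 r : R, 0 < r &
    forall y, (forall i, `|x i - y i| < r) -> U y) ->
  measurable [set w | U (fun i => V i w)].
Proof.
move=> oU.
pose B i (j n : nat) := [set w | `|V i w - e j| < n.+1%:R^-1].
have mB i j n : measurable (B i j n).
  rewrite (_ : B i j n = V i @^-1` ball (e j) n.+1%:R^-1).
    rewrite -[_ @^-1` _]setTI; apply: hV => //.
    by apply: open_borel; exact: ball_open.
  by apply/seteqP; split => w /=; rewrite /B -ball_normE /ball_/= distrC.
(* The products of balls with centres in the dense sequence and radius 1/(n+1)
   that lie inside U. *)
pose good (p : {ffun 'I_k -> nat} * nat) :=
  forall y, (forall i, `|y i - e (p.1 i)| < p.2.+1%:R^-1) -> U y.
pose F p := if `[< good p >] then \bigcap_i B i (p.1 i) p.2 else set0.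
rewrite (_ : [set _ | _] = \bigcup_p F p).
  apply: countable_bigcupT_measurable => [|p]; first exact: countableP.
  rewrite /F; case: ifP => _ //.
  by apply: fin_bigcap_measurable => //; exact: finite_finset.
apply/seteqP; split => w /=; last first.
  move=> [p _]; rewrite /F; case: ifPn => // /asboolP gp Bw.
  by apply: gp => i; exact: (Bw i Logic.I).
move=> /oU[r r0 Ur].
pose n := Num.truncn (2 / r).
(* Twice the radius is below r, so a ball around a point of the dense sequence
   that contains [V i w] lies in the r-ball around [V i w]. *)
have nr : n.+1%:R^-1 + n.+1%:R^-1 < r.
  rewrite -mulr2n -[ltLHS]mulr_natr ltr_pdivrMl// -ltr_pdivrMr//.
  exact: truncnS_gt.
have n0 : (0 : R) < n.+1%:R^-1 by rewrite invr_gt0.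
have [f fP] := choice (fun i => he (V i w) n0).
exists (finfun f, n) => //; rewrite /F asboolT.
  by move=> i _; rewrite /B/= ffunE.
move=> y /= yf; apply: Ur => i; apply: lt_trans nr.
have := yf i; rewrite ffunE => yfi.
rewrite -(subrKA (e (f i))) (le_lt_trans (ler_normD _ _))// ltrD//.
by rewrite distrC.
Qed.

Lemma random_vector_continuous (q : ('I_k -> X) -> X) (K : R) :
  (forall x y, `|q x - q y| <= K * \sum_i `|x i - y i|) ->
  random_element (fun w => q (fun i => V i w)).
Proof.
move=> qK; rewrite /random_element.
apply: (@measurability _ _ _ _ setT (_ : Omega -> borel X) (@open X) erefl).
move=> _ [U oU <-]; rewrite setTI.
apply: (@random_vector_open_measurable (q @^-1` U)) => x /= Ux.
have /nbhs_ballP[eps /= e0 eU] : nbhs (q x) U by exact: open_nbhs_nbhs.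
have [r r0 Hr] := lipschitz_uniform k K e0.
exists r => // y xy; apply: eU; rewrite -ball_normE /ball_/=.
by rewrite (le_lt_trans (qK _ _))// Hr.
Qed.

Lemma random_vector_real_measurable (q : ('I_k -> X) -> R) (K : R) :
  (forall x y, `|q x - q y| <= K * \sum_i `|x i - y i|) ->
  measurable_fun setT (fun w => q (fun i => V i w)).
Proof.
move=> qK; apply: (measurability _ (RGenOInfty.measurableE R)).
move=> _ [_ [t ->] <-]; rewrite setTI.
apply: (@random_vector_open_measurable [set x | `]t, +oo[%classic (q x)]) => x /=.
rewrite in_itv/= andbT => tq.
have qt0 : 0 < q x - t by rewrite subr_gt0.
have [r r0 Hr] := lipschitz_uniform k K qt0.
exists r => // y xy; rewrite in_itv/= andbT.
have := le_lt_trans (le_trans (ler_norm _) (qK x y)) (Hr _ _ xy); lra.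
Qed.

End Vectors.
End RandomElements.

(** * Lipschitz test functions for convergence in distribution *)

Section LipschitzApproximation.
Context (R : realType) (X : completeNormedModType R).

Definition lipschitz_bounded (f : X -> R) :=
  exists L M : R, (forall x y, `|f x - f y| <= L * `|x - y|) /\ forall x, `|f x| <= M.

(** The witnesses are the inf-convolutions g_j(x) = inf over y of f(y) + j |x
    - y|. A point y with |x - y| >= r contributes at least -M + jr, which
    exceeds f(x) for large j, so only the values of f near x matter in the
    limit. *)
Lemma lipschitz_approximation (f : X -> R) (M : R) : continuous f ->
  (forall x, `|f x| <= M) ->
  exists g : nat -> X -> R, [/\ forall j x, `|g j x| <= M,
    forall j x y, `|g j x - g j y| <= j%:R * `|x - y|,
    forall j x, g j x <= f x & forall x, g ^~ x @ \oo --> f x].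
Proof.
move=> cf fM.
pose S (j : nat) x := [set f y + j%:R * `|x - y| | y in [set: X]].
have Slb j x : lbound (S j x) (- M).
  move=> _ [y _ <-]; have := fM y; rewrite ler_norml => /andP[+ _].
  by move/le_trans; apply; rewrite lerDl mulr_ge0.
have hS j x : has_lbound (S j x) by exists (- M).
have S0 j x : S j x !=set0 by exists (f x + j%:R * `|x - x|), x.
pose g j x := inf (S j x).
have gf j x : g j x <= f x.
  by apply: ge_inf => //; exists x => //; rewrite subrr normr0 mulr0 addr0.
have gM j x : - M <= g j x by apply: lb_le_inf.
have fM' x : f x <= M by have := fM x; rewrite ler_norml => /andP[].
have gL j x y : g j x <= g j y + j%:R * `|x - y|.
  rewrite -lerBlDr; apply: lb_le_inf => // _ [z _ <-].
  rewrite lerBlDr; apply: (@le_trans _ _ (f z + j%:R * `|x - z|)).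
    by apply: ge_inf => //; exists z.
  rewrite -addrA lerD2l -mulrDr ler_wpM2l// [leRHS]addrC.
  by rewrite -(subrKA y) ler_normD.
exists g; split => //.
- by move=> j x; rewrite ler_norml gM (le_trans (gf _ _)).
- move=> j x y; rewrite ler_norml; have := gL j x y; have := gL j y x.
  rewrite (distrC y x); lra.
move=> x; apply/cvgrPdist_le => eps e0.
have /cvgrPdist_lt/(_ _ e0)/nbhs_ballP[r /= r0 Hr] := cf x.
have [J _ HJ] : \forall j \near \oo, 2 * M / r <= j%:R.
  exact: nbhs_infty_ger.
exists J => // j /= /HJ; rewrite ler_pdivrMr// => jr.
rewrite ger0_norm ?subr_ge0// lerBlDr addrC -lerBlDr.
apply: lb_le_inf => // _ [y _ <-].
have [xy|xy] := ltP `|x - y| r.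
  have := Hr y; rewrite -ball_normE => /(_ xy); rewrite ltr_norml => /andP[_ h].
  by rewrite -[leLHS]addr0 lerD ?mulr_ge0//; lra.
have h1 : j%:R * r <= j%:R * `|x - y| by rewrite ler_wpM2l.
have := fM' x; have := fM y; rewrite ler_norml => /andP[]; lra.
Qed.

Lemma lipschitz_continuous (f : X -> R) (L : R) :
  (forall x y, `|f x - f y| <= L * `|x - y|) -> continuous f.
Proof.
move=> fL x; apply/cvgrPdist_lt => eps e0.
pose L' := `|L| + 1; have L0 : 0 < L' by rewrite ltr_wpDl.
apply/nbhs_ballP; exists (eps / L'); first by rewrite /= divr_gt0.
move=> y; rewrite -ball_normE /= ltr_pdivlMr// => xy.
rewrite (le_lt_trans (fL _ _))// (le_lt_trans _ xy)// mulrC ler_wpM2l//.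
by rewrite (le_trans (ler_norm _))// lerDl.
Qed.

Lemma bounded_fun_le (f : X -> R) : bounded_fun f -> exists M, forall x, `|f x| <= M.
Proof.
move=> [M [_ HM]]; exists (M + 1) => x; apply: HM => //.
by rewrite ltrDl.
Qed.

Context (d1 : measure_display) (O1 : measurableType d1) (P1 : probability O1 R)
  (d2 : measure_display) (O2 : measurableType d2) (P2 : probability O2 R).
Variables (V : nat -> O1 -> X) (W : O2 -> X).
Hypotheses (mV : forall n, random_element (V n)) (mW : random_element W).

Lemma random_element_bounded (d : measure_display) (Om : measurableType d)
    (Z : Om -> X) (f : X -> R) M : random_element Z -> continuous f ->
  (forall x, `|f x| <= M) -> bounded_measurable (fun w => f (Z w)).
Proof.
move=> mZ cf fM; split; last by exists M.
by apply: (measurableT_comp (continuous_real_measurable cf) mZ).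
Qed.

(** A continuous f is a pointwise limit of Lipschitz functions below f. This
    bounds the means of f from below in the limit, and the same argument for
    -f bounds them from above. *)
Lemma portmanteau_lipschitz :
  (forall f, lipschitz_bounded f ->
    \int[P1]_w f (V n w) @[n --> \oo] --> \int[P2]_w f (W w)) ->
  forall f : X -> R, continuous f -> bounded_fun f ->
    \int[P1]_w f (V n w) @[n --> \oo] --> \int[P2]_w f (W w).
Proof.
move=> H.
have lower (f : X -> R) M : continuous f -> (forall x, `|f x| <= M) ->
    forall eps : R, 0 < eps -> \forall n \near \oo,
    \int[P2]_w f (W w) - eps < \int[P1]_w f (V n w).
  move=> cf fM eps e0.
  have [g [gM gL gf gcvg]] := lipschitz_approximation cf fM.
  have cg j : continuous (g j) by apply: lipschitz_continuous; exact: gL.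
  have e20 : 0 < eps / 2 by rewrite divr_gt0.
  have bgW j : bounded_measurable (fun w => g j (W w)).
    exact: random_element_bounded mW (cg j) (gM j).
  have : \int[P2]_w g j (W w) @[j --> \oo] --> \int[P2]_w f (W w).
    apply: (mean_dominated_cvg (C := M)) => //.
    - by move=> j; have [] := bgW j.
    - exact: random_element_bounded mW cf fM.
  move=> /cvgrPdist_lt/(_ _ e20)[J _ /(_ J (leqnn J))] /=.
  rewrite ltr_norml => /andP[_ hJ].
  have /cvgrPdist_lt/(_ _ e20) : \int[P1]_w g J (V n w) @[n --> \oo] -->
      \int[P2]_w g J (W w).
    by apply: H; exists J%:R, M.
  apply: filterS => n; rewrite ltr_norml => /andP[_ hn].
  have : \int[P1]_w g J (V n w) <= \int[P1]_w f (V n w).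
    apply: le_mean => //.
      exact: random_element_bounded (mV n) (cg J) (gM J).
    exact: random_element_bounded (mV n) cf fM.
  lra.
move=> f cf /bounded_fun_le[M fM]; apply/cvgrPdist_lt => eps e0.
have cNf : continuous (fun x => - f x) by move=> x; apply: cvgN; exact: cf.
have NfM x : `|- f x| <= M by rewrite normrN.
have EN (d : measure_display) (Om : measurableType d) (P : probability Om R)
    (Z : Om -> X) : random_element Z ->
    \int[P]_w (- f (Z w)) = - \int[P]_w f (Z w).
  move=> mZ; under eq_Rintegral do rewrite -mulN1r.
  by rewrite meanZ ?mulN1r//; exact: random_element_bounded mZ cf fM.
have h1 := lower f M cf fM eps e0.
have h2 := lower _ M cNf NfM eps e0.
near=> n.
have : \int[P2]_w f (W w) - eps < \int[P1]_w f (V n w) by near: n.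
have : \int[P2]_w (- f (W w)) - eps < \int[P1]_w (- f (V n w)) by near: n.
rewrite !EN// ltr_norml; lra.
Unshelve. all: by end_near.
Qed.

End LipschitzApproximation.

(** * Partitions of unity and products of weakly convergent laws *)

Lemma cvg_prod_seq (R : numFieldType) (T I : Type)
    (F : set_system T) (FF : Filter F) (r : seq I) (f : I -> T -> R) (a : I -> R) :
  (forall i, f i @ F --> a i) ->
  (fun x => \prod_(i <- r) f i x) @ F --> \prod_(i <- r) a i.
Proof.
move=> fa; elim: r => [|i r IH].
  by under eq_fun do rewrite big_nil; rewrite big_nil; exact: cvg_cst.
under eq_fun do rewrite big_cons.
by rewrite big_cons; apply: cvgM.
Qed.

Section PartitionOfUnity.
Context (R : realType) (X : completeNormedModType R) (e : nat -> X).
Hypothesis he : forall x (eps : R), 0 < eps -> exists j, `|x - e j| < eps.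
Variable (delta : R).
Hypothesis delta0 : 0 < delta.

(** Equal to 1 on the ball of radius delta/2 around [e j] and to 0 outside the
    ball of radius delta. *)
Definition bump (j : nat) (x : X) : R :=
  Num.min 1 (Num.max 0 (2 - 2 / delta * `|x - e j|)).

(** What is left of the constant 1 after the first j functions of the
    partition have been removed. *)
Definition residual (j : nat) (x : X) : R := \prod_(i < j) (1 - bump i x).

(** The finite partition of unity obtained by stopping at J. Its last member,
    the index J, collects the rest and is the only one whose support is not
    small. *)
Definition partition_fun (J j : nat) (x : X) : R :=
  if (j < J)%N then bump j x * residual j x else residual J x.

Lemma bump01 j x : 0 <= bump j x <= 1.
Proof. by rewrite le_min ler01 le_max lexx/= ge_min lexx. Qed.

Lemma residual01 j x : 0 <= residual j x <= 1.
Proof.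
have h i : 0 <= 1 - bump i x <= 1 by have := bump01 i x; lra.
rewrite prodr_ge0 => [|i _]; last by have /andP[] := h i.
by apply: prodr_ile1 => i _.
Qed.

Lemma partition_fun01 J j x : 0 <= partition_fun J j x <= 1.
Proof.
rewrite /partition_fun; case: ifP => _; last exact: residual01.
have /andP[? ?] := bump01 j x; have /andP[? ?] := residual01 j x.
by rewrite mulr_ge0// mulr_ile1.
Qed.

Lemma residualS j x : residual j.+1 x = residual j x * (1 - bump j x).
Proof. by rewrite /residual big_ord_recr. Qed.

Lemma partition_fun_sum J x : \sum_(j < J.+1) partition_fun J j x = 1.
Proof.
rewrite big_ord_recr/= {2}/partition_fun ltnn.
rewrite (eq_bigr (fun j : 'I_J => bump j x * residual j x)); last first.
  by move=> j _; rewrite /partition_fun ltn_ord.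
elim: J => [|J IH]; first by rewrite /residual !big_ord0 add0r.
rewrite big_ord_recr/= residualS -[RHS]IH -addrA; congr (_ + _); ring.
Qed.

Lemma partition_fun_support J j x : (j < J)%N -> partition_fun J j x != 0 ->
  `|x - e j| < delta.
Proof.
move=> jJ; rewrite /partition_fun jJ mulf_eq0 negb_or => /andP[+ _].
apply: contraR; rewrite -leNgt => h.
have : 2 - 2 / delta * `|x - e j| <= 0.
  by rewrite subr_le0 -mulrA ler_pMr// ler_pdivlMl// mulr1.
by move=> h'; rewrite /bump max_l// min_r.
Qed.

Lemma bump_continuous j : continuous (bump j).
Proof.
pose g (x : X) : R^o := 2 - 2 / delta * `|x - e j|.
have cg x : {for x, continuous g}.
  apply: cvgB; first exact: cvg_cst.
  apply: cvgM; first exact: cvg_cst.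
  by apply: cvg_norm; apply: cvgB; [exact: cvg_id|exact: cvg_cst].
move=> x.
have c0 : {for x, continuous (cst (0 : R^o) : X -> R^o)} by exact: cvg_cst.
have c1 : {for x, continuous (cst (1 : R^o) : X -> R^o)} by exact: cvg_cst.
exact: (continuous_min c1 (continuous_max c0 (cg x))).
Qed.

Lemma residual_continuous j : continuous (residual j).
Proof.
move=> x; rewrite /residual; apply: cvg_prod_seq => i.
by apply: cvgB; [exact: cvg_cst|exact: bump_continuous].
Qed.

Lemma partition_fun_continuous J j : continuous (partition_fun J j).
Proof.
move=> x; have [jJ|Jj] := ltnP j J.
  have -> : partition_fun J j = fun y => bump j y * residual j y.
    by apply/funext => y; rewrite /partition_fun jJ.
  by apply: cvgM; [exact: bump_continuous|exact: residual_continuous].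
have -> : partition_fun J j = residual J.
  by apply/funext => y; rewrite /partition_fun ltnNge Jj.
exact: residual_continuous.
Qed.

(** Some [e j] lies within delta/2 of x, and the j-th factor vanishes
    there. *)
Lemma residual_cvg0 x : residual ^~ x @ \oo --> 0.
Proof.
have [j xj] := he x (divr_gt0 delta0 (ltr0n R 2)).
apply: cvg_near_cst; exists j.+1 => // J /= jJ.
rewrite /residual (bigD1 (Ordinal jJ))//= (_ : bump j x = 1) ?subrr ?mul0r//.
rewrite /bump min_l// le_max; apply/orP; right.
have : 2 / delta * `|x - e j| <= 1; last by lra.
by rewrite mulrAC ler_pdivrMr// mul1r mulrC -ler_pdivlMr// ltW.
Qed.

Section Vectors.
Variables (k : nat) (h : ('I_k -> X) -> R) (M L : R).
Hypothesis hM : forall x, `|h x| <= M.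
Hypothesis hL : forall x y, `|h x - h y| <= L * \sum_i `|x i - y i|.
Variable J : nat.
Implicit Types (x : 'I_k -> X) (f : {ffun 'I_k -> 'I_J.+1}).

Definition grid_approx x : R :=
  \sum_(f : {ffun 'I_k -> 'I_J.+1}) h (fun i => e (f i)) * \prod_i partition_fun J (f i) (x i).

(** The product over i of the sums over j, each equal to 1, expanded by
    distributivity. *)
Lemma grid_sum1 x : \sum_(f : {ffun 'I_k -> 'I_J.+1}) \prod_i partition_fun J (f i) (x i) = 1.
Proof.
rewrite -(bigA_distr_bigA (fun i (j : 'I_J.+1) => partition_fun J j (x i))).
by rewrite big1// => i _; exact: partition_fun_sum.
Qed.

(** Summing the product weights over all other coordinates leaves the weight
    of the i-th coordinate alone. *)
Lemma grid_marginal x i :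
  \sum_(f : {ffun 'I_k -> 'I_J.+1}) (f i == ord_max)%:R * \prod_i' partition_fun J (f i') (x i')
  = residual J (x i).
Proof.
(* The indicator of [f i = J] is absorbed in the i-th factor, so that
   distributivity applies. *)
pose G i' (j : 'I_J.+1) := (if i' == i then (j == ord_max)%:R else 1) *
  partition_fun J j (x i').
rewrite (eq_bigr (fun f : {ffun 'I_k -> 'I_J.+1} => \prod_i' G i' (f i'))).
  rewrite -(bigA_distr_bigA G) (bigD1 i)//= [X in _ * X]big1 ?mulr1.
    rewrite /G eqxx big_ord_recr/= big1 ?add0r => [|j _]; last first.
      by rewrite -val_eqE/= ltn_eqF ?mul0r.
    by rewrite eqxx mul1r /partition_fun ltnn.
  move=> i' /negbTE i'i; rewrite /G i'i -[RHS](partition_fun_sum J (x i')).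
  by apply: eq_bigr => j _; rewrite mul1r.
move=> f _; rewrite /G big_split/=; congr (_ * _).
by rewrite (bigD1 i)//= eqxx big1 ?mulr1// => i' /negbTE ->.
Qed.

(** The difference is an average of [h x - h (e o f)] with the product
    weights. If all weights involved come from small balls, each coordinate is
    displaced by less than delta; the remaining grid indices use the residual
    function in some coordinate i, and their total weight is at most the sum
    of the residuals. *)
Lemma grid_approx_error x : 0 <= L ->
  `|h x - grid_approx x| <= L * (k%:R * delta) + M *+ 2 * \sum_i residual J (x i).
Proof.
move=> L0.
have M0 : 0 <= M by exact: le_trans (hM x).
have P0 f : 0 <= \prod_i partition_fun J (f i) (x i).
  by apply: prodr_ge0 => i _; have /andP[] := partition_fun01 J (f i) (x i).
have -> : h x - grid_approx x =
    \sum_(f : {ffun 'I_k -> 'I_J.+1}) (h x - h (fun i => e (f i))) * \prod_i partition_fun J (f i) (x i).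
  under [RHS]eq_bigr do rewrite mulrBl.
  by rewrite sumrB -mulr_sumr grid_sum1 mulr1.
apply: (@le_trans _ _ (\sum_(f : {ffun 'I_k -> 'I_J.+1}) (L * (k%:R * delta) +
    M *+ 2 * \sum_i (f i == ord_max)%:R) * \prod_i partition_fun J (f i) (x i))).
  apply: le_trans (ler_norm_sum _ _ _) _; apply: ler_sum => f _.
  rewrite normrM [X in _ * X <= _]ger0_norm//.
  have [->|Pn0] := eqVneq (\prod_i partition_fun J (f i) (x i)) 0.
    by rewrite !mulr0.
  rewrite ler_wpM2r//.
  have M20 : 0 <= M *+ 2 by rewrite mulrn_wge0.
  have Lkd : 0 <= L * (k%:R * delta) by rewrite !mulr_ge0// ltW.
  (* A grid index using the residual function is charged the trivial bound 2M;
     the others are close to x in every coordinate. *)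
  have [/existsP[i0 /eqP fi0]|/existsPn fn] := boolP [exists i, f i == ord_max].
    rewrite -[leLHS]add0r lerD//; apply: (@le_trans _ _ (M *+ 2 * 1)).
      by rewrite mulr1 mulr2n (le_trans (ler_normB _ _))// lerD.
    rewrite ler_wpM2l// (bigD1 i0)//= fi0 eqxx lerDl.
    by apply: sumr_ge0 => i _; rewrite ler0n.
  rewrite -[leLHS]addr0 lerD//; last first.
    by rewrite mulr_ge0// sumr_ge0// => i _; rewrite ler0n.
  rewrite (le_trans (hL _ _))// ler_wpM2l// mulr_natl -[X in _ *+ X]card_ord.
  rewrite -sumr_const; apply: ler_sum => i _; apply/ltW.
  apply: (@partition_fun_support J).
    by rewrite ltn_neqAle -ltnS ltn_ord andbT; have := fn i.
  by apply: contraNneq Pn0 => h0; rewrite (bigD1 i)//= h0 mul0r.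
under eq_bigr do rewrite mulrDl -(mulrA (M *+ 2)) mulr_suml.
rewrite big_split/= -!mulr_sumr grid_sum1 mulr1 lerD// ler_wpM2l ?mulrn_wge0//.
rewrite exchange_big/=; apply: ler_sum => i _.
by rewrite grid_marginal.
Qed.

End Vectors.
End PartitionOfUnity.

Section ProductConvergence.
Context (R : realType) (X : completeNormedModType R) (e : nat -> X).
Hypothesis he : forall x (eps : R), 0 < eps -> exists j, `|x - e j| < eps.

Definition test_fun (phi : X -> R) := continuous phi /\ forall x, 0 <= phi x <= 1.

Lemma test_fun_norm phi : test_fun phi -> forall x, `|phi x| <= 1.
Proof. by move=> [_ p01] x; have /andP[? ?] := p01 x; rewrite ger0_norm. Qed.

Lemma test_fun1 : test_fun (fun=> 1).
Proof. by split; [move=> x; exact: cvg_cst|move=> _; rewrite ler01 lexx]. Qed.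

Section ProductRule.
Context (d : measure_display) (O : measurableType d) (P : probability O R)
  (d' : measure_display) (O' : measurableType d') (P' : probability O' R)
  (k : nat) (V : 'I_k -> O -> X) (Z : O' -> X).

(** The components of V are independent with the law of Z, as far as test
    functions can tell. *)
Definition product_rule := forall phi : 'I_k -> X -> R,
  (forall i, test_fun (phi i)) ->
  \int[P]_w (\prod_i phi i (V i w)) = \prod_i \int[P']_w phi i (Z w).

Hypothesis hV : forall i, random_element (V i).
Hypothesis rule : product_rule.

Lemma product_rule_marginal i phi : test_fun phi ->
  \int[P]_w phi (V i w) = \int[P']_w phi (Z w).
Proof.
move=> tphi; pose psi j := if j == i then phi else (fun=> 1).
have tpsi j : test_fun (psi j) by rewrite /psi; case: eqP => // _; exact: test_fun1.
have := rule tpsi; rewrite [RHS](bigD1 i)//= [X in _ * X]big1 ?mulr1; last first.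
  by move=> j /negbTE ji; rewrite /psi ji mean_cst.
rewrite /psi eqxx => <-; congr Rintegral; apply/funext => w.
rewrite (bigD1 i)//= eqxx big1 ?mulr1// => j /negbTE ji.
by rewrite ji.
Qed.

(** The mean of the grid approximation is computed from the means of test
    functions of Z alone, which is what makes it converge when the law of Z
    does. *)
Lemma mean_grid_approx (h : ('I_k -> X) -> R) (M L delta : R) (J : nat) :
  0 < delta -> 0 <= L -> (forall x, `|h x| <= M) ->
  (forall x y, `|h x - h y| <= L * \sum_i `|x i - y i|) ->
  `|\int[P]_w h (fun i => V i w) -
    \sum_(f : {ffun 'I_k -> 'I_J.+1}) h (fun i => e (f i)) *
      \prod_i \int[P']_w partition_fun e delta J (f i) (Z w)| <=
  L * (k%:R * delta) + M *+ 2 * (k%:R * \int[P']_w residual e delta J (Z w)).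
Proof.
move=> d0 L0 hM hL.
have tpart j : test_fun (partition_fun e delta J j).
  split; first exact: partition_fun_continuous.
  by move=> x; exact: partition_fun01.
have tres : test_fun (residual e delta J).
  split; first exact: residual_continuous.
  by move=> x; exact: residual01.
have bV i phi : test_fun phi -> bounded_measurable (fun w => phi (V i w)).
  move=> tphi; apply: random_element_bounded (test_fun_norm tphi) => //.
  by have [] := tphi.
have bP (f : {ffun 'I_k -> 'I_J.+1}) : bounded_measurable (fun w =>
    \prod_i partition_fun e delta J (f i) (V i w)).
  by apply: bounded_measurable_prod => i; exact: bV.
have bt (f : {ffun 'I_k -> 'I_J.+1}) : bounded_measurable (fun w =>
    h (fun i => e (f i)) * \prod_i partition_fun e delta J (f i) (V i w)).
  by apply: bounded_measurableM => //; exact: bounded_measurable_cst.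
have -> : \sum_(f : {ffun 'I_k -> 'I_J.+1}) h (fun i => e (f i)) *
      \prod_i \int[P']_w partition_fun e delta J (f i) (Z w) =
    \int[P]_w grid_approx e delta h J (fun i => V i w).
  rewrite mean_sum//; apply: eq_bigr => f _.
  rewrite meanZ//; congr (_ * _).
  by rewrite (rule (phi := fun i => partition_fun e delta J (f i))).
have -> : k%:R * \int[P']_w residual e delta J (Z w) =
    \int[P]_w \sum_i residual e delta J (V i w).
  rewrite mean_sum; last by move=> i; exact: bV.
  rewrite (eq_bigr (fun=> \int[P']_w residual e delta J (Z w))); last first.
    by move=> i _; exact: product_rule_marginal.
  by rewrite sumr_const card_ord mulr_natl.
have bS : bounded_measurable (fun w => \sum_i residual e delta J (V i w)).
  by apply: bounded_measurable_sum => i; exact: bV.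
have bMS : bounded_measurable (fun w => M *+ 2 * \sum_i residual e delta J (V i w)).
  by apply: bounded_measurableM => //; exact: bounded_measurable_cst.
rewrite -meanZ// -(mean_cst P (L * _)) -meanD//; last first.
  exact: bounded_measurable_cst.
apply: le_mean_dist.
- split; last by exists M.
  exact: (random_vector_real_measurable he hV hL).
- exact: bounded_measurable_sum.
- by apply: bounded_measurableD => //; exact: bounded_measurable_cst.
- by move=> w; exact: grid_approx_error.
Qed.

End ProductRule.

Context (d : measure_display) (O : measurableType d) (P : probability O R)
  (d1 : measure_display) (O1 : measurableType d1) (P1 : probability O1 R)
  (d2 : measure_display) (O2 : measurableType d2) (P2 : probability O2 R)
  (k : nat) (V : nat -> 'I_k -> O -> X) (Z : nat -> O -> X)
  (Vlim : 'I_k -> O2 -> X) (Y : O1 -> X).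
Hypotheses (hV : forall n i, random_element (V n i))
  (hVlim : forall i, random_element (Vlim i)) (hY : random_element Y).

(** Let delta and then J be chosen so that the approximation errors are small
    under Y. For these fixed values the grid approximation and the mean of the
    residual are finite expressions in means of test functions, so they
    converge. *)
Lemma product_weak_convergence :
  (forall n, product_rule P P (V n) (Z n)) -> product_rule P2 P1 Vlim Y ->
  (forall phi, test_fun phi ->
    \int[P]_w phi (Z n w) @[n --> \oo] --> \int[P1]_w phi (Y w)) ->
  forall (h : ('I_k -> X) -> R) (M L : R), (forall x, `|h x| <= M) ->
  (forall x y, `|h x - h y| <= L * \sum_i `|x i - y i|) ->
  \int[P]_w h (fun i => V n i w) @[n --> \oo] -->
  \int[P2]_w h (fun i => Vlim i w).
Proof.
move=> rV rVlim ZY h M L hM hL.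
wlog L0 : L hL / 0 <= L.
  move=> /(_ `|L|); apply => // x y; apply: le_trans (hL x y) _.
  by rewrite ler_wpM2r ?ler_norm// sumr_ge0.
have M0 : 0 <= M by exact: le_trans (hM (fun=> 0)).
apply/cvgrPdist_lt => eps eps0.
pose c := L * k%:R; have c0 : 0 <= c by rewrite mulr_ge0.
pose delta := eps / 4 / (c + 1).
have delta0 : 0 < delta by rewrite !divr_gt0// ltr_wpDl.
have cd : c * delta < eps / 4.
  rewrite /delta mulrCA gtr_pMr ?divr_gt0// ltr_pdivrMr ?ltr_wpDl// mul1r.
  by rewrite ltrDl.
have tpart J j : test_fun (partition_fun e delta J j).
  split; first exact: partition_fun_continuous.
  by move=> x; exact: partition_fun01.
have tres J : test_fun (residual e delta J).
  split; first exact: residual_continuous.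
  by move=> x; exact: residual01.
pose m := M *+ 2 * k%:R; have m0 : 0 <= m by rewrite mulr_ge0// mulrn_wge0.
have [J rJ] : exists J, m * \int[P1]_w residual e delta J (Y w) < eps / 8.
  have h1 : \int[P1]_w residual e delta J (Y w) @[J --> \oo] --> 0.
    rewrite -[X in _ --> X](mean_cst P1 0).
    have bJ J : bounded_measurable (fun w => residual e delta J (Y w)).
      exact: random_element_bounded hY (tres J).1 (test_fun_norm (tres J)).
    apply: (mean_dominated_cvg (C := 1)).
    - by move=> J; have [] := bJ J.
    - by move=> J w; exact: test_fun_norm.
    - by move=> w; exact: residual_cvg0.
    - exact: bounded_measurable_cst.
  have : m * \int[P1]_w residual e delta J (Y w) @[J --> \oo] --> m * 0.
    by apply: cvgM => //; exact: cvg_cst.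
  rewrite mulr0 => /cvgr_lt/(_ (eps / 8))[|J _ /(_ J (leqnn J)) HJ].
    by rewrite divr_gt0.
  by exists J.
pose A n := \sum_(f : {ffun 'I_k -> 'I_J.+1}) h (fun i => e (f i)) *
  \prod_i \int[P]_w partition_fun e delta J (f i) (Z n w).
pose Alim := \sum_(f : {ffun 'I_k -> 'I_J.+1}) h (fun i => e (f i)) *
  \prod_i \int[P1]_w partition_fun e delta J (f i) (Y w).
have AAlim : A n @[n --> \oo] --> Alim.
  apply: cvg_sum_seq => f; apply: cvgM; first exact: cvg_cst.
  by apply: cvg_prod_seq => i; exact: ZY.
have resc : m * \int[P]_w residual e delta J (Z n w) @[n --> \oo] -->
    m * \int[P1]_w residual e delta J (Y w).
  by apply: cvgM; [exact: cvg_cst|exact: ZY].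
have e8 : 0 < eps / 8 by rewrite divr_gt0.
move/cvgrPdist_lt : AAlim => /(_ _ e8) AAlim.
move/cvgr_lt : resc => /(_ _ rJ) resc.
near=> n.
have h1 := mean_grid_approx (hV n) (rV n) J delta0 L0 hM hL.
have h2 := mean_grid_approx hVlim rVlim J delta0 L0 hM hL.
have h3 : `|Alim - A n| < eps / 8 by near: n.
have h4 : m * \int[P]_w residual e delta J (Z n w) < eps / 8 by near: n.
move: h1 h2 h3; rewrite -/(A n) -/Alim (mulrA L) (mulrA (M *+ 2)) -/c -/m => h1 h2 h3.
move: h2 h1 h3; rewrite (mulrA (M *+ 2)) -/m.
rewrite !ler_norml !ltr_norml => /andP[? ?] /andP[? ?] /andP[? ?].
by apply/andP; split; lra.
Unshelve. all: by end_near.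
Qed.

End ProductConvergence.

(** * The quantile of the block estimators *)

Section QuantileEstimator.
Context (R : realType) (X : completeNormedModType R)
  (d : nat -> X) (hd : unconditional_schauder_basis d)
  (theta0 : X) (k : nat) (hk : (0 < k)%N)
  (alpha : nat -> R) (halpha : forall l, 0 < alpha l < 1)
  (dO : measure_display) (Omega : measurableType dO) (P : probability Omega R)
  (dE : measure_display) (E : measurableType dE)
  (xi : nat -> Omega -> E) (hxi : iid P xi)
  (g : forall m : nat, m.-tuple E -> X)
  (hg : forall m : nat, random_element (g m))
  (b : forall n : nat, 'I_k -> 'I_(n %/ k) -> 'I_n)
  (hb : disjoint_blocks b).

Local Notation Z := (estimator g xi).
Local Notation B := (block_estimator g xi b).
Local Notation T := (schauder_quantile_estimator g xi d alpha b).
Local Notation qS := (schauder_quantile d alpha).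

Lemma cvg_divn : (n %/ k)%N @[n --> \oo] --> \oo.
Proof.
move=> A [N _ HN]; exists (N * k)%N => // n /= Nn.
by apply: HN; rewrite /= leq_divRL.
Qed.

Lemma estimator_random_element m : random_element (Z m).
Proof.
exact: (measurableT_comp (@hg m) (measurable_sample hxi (@nat_of_ord m))).
Qed.

Lemma block_random_element n i : random_element (B n i).
Proof.
have ms : measurable_fun setT (fun w => [tuple xi (@b n i j) w | j < n %/ k]).
  exact: (measurable_sample hxi (fun j => @b n i j : nat)).
exact: (measurableT_comp (@hg (n %/ k)%N) ms).
Qed.

Lemma block_injective n : injective (fun p : 'I_k * 'I_(n %/ k) => @b n p.1 p.2 : nat).
Proof. by move=> p q pq; apply: (@hb n); exact: val_inj. Qed.

Lemma schauder_quantile_cst (x : X) : qS (fun _ : 'I_k => x) = x.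
Proof.
transitivity (0 *: qS (fun _ : 'I_k => 0) + x); last by rewrite scale0r add0r.
rewrite -(schauder_quantile_affine hd hk halpha)//; congr (schauder_quantile _ _ _).
by apply/funext => i; rewrite scale0r add0r.
Qed.

Lemma schauder_quantile_lipschitz_ex : exists2 K, 0 <= K &
  forall x y : 'I_k -> X, `|qS x - qS y| <= K * \sum_i `|x i - y i|.
Proof.
have [K K0 HK] := unconditional_constant hd.
by exists K => //; exact: schauder_quantile_lipschitz.
Qed.

Lemma quantile_estimator_random_element n : random_element (T n).
Proof.
have [e he] := schauder_basis_separable hd.
have [K K0 HK] := schauder_quantile_lipschitz_ex.
exact: (random_vector_continuous he (block_random_element n) HK).
Qed.

Lemma affine_random_element (d' : measure_display) (Om : measurableType d')
    (V : Om -> X) (a : R) (x : X) :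
  random_element V -> random_element (fun w => a *: (V w - x)).
Proof.
move=> mV.
have cf : continuous (fun v : X => a *: (v - x)).
  by move=> v; apply: cvgZl_tmp; apply: cvgB; [exact: cvg_id|exact: cvg_cst].
exact: (measurableT_comp (continuous_borel_measurable cf) mV).
Qed.

(** Each block is a sample of [n %/ k] distinct observations, as is the one
    from which [Z (n %/ k)] is computed. *)
Lemma block_law n i : same_law P (B n i : Omega -> borel X) P
  (Z (n %/ k)%N : Omega -> borel X).
Proof.
move=> A mA.
have mgA : measurable (@g (n %/ k)%N @^-1` A).
  by rewrite -[_ @^-1` _]setTI; exact: (@hg (n %/ k)%N).
apply: (@sample_law _ _ _ _ _ _ _ hxi _ (fun j => @b n i j : nat) (@nat_of_ord _)) mgA.
  by move=> j j' jj'; have [] := @block_injective n (i, j) (i, j') jj'.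
exact: ord_inj.
Qed.

(** If every block estimator is closer than r to theta0 then T is closer than
    eps, for an r given by the Lipschitz bound. So the probability of an error
    of T is at most k times that of an error of one block. *)
Lemma quantile_estimator_consistent :
  cvg_in_probability P Z theta0 -> cvg_in_probability P T theta0.
Proof.
move=> [_ Zc]; split; first exact: quantile_estimator_random_element.
move=> eps eps0.
have [K K0 HK] := schauder_quantile_lipschitz_ex.
have [r r0 Hr] := @lipschitz_uniform R X k K _ eps0.
have r20 : 0 < r / 2 by rewrite divr_gt0.
have mdist (V : Omega -> X) (s : R) : random_element V ->
    measurable [set w | s < `|V w - theta0|].
  move=> mV; rewrite -[X in measurable X]setTI.
  apply: (@measurable_fun_ltr _ _ _ _ (fun=> s) (fun w => `|V w - theta0|)) => //.
  apply: (@measurableT_comp _ _ _ _ _ _ ((fun v => `|v - theta0|) : borel X -> R)) => //.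
  apply: continuous_real_measurable => v.
  by apply: cvg_norm; apply: cvgB; [exact: cvg_id|exact: cvg_cst].
pose p n := P [set w | r / 2 < `|Z n w - theta0|].
have pk : p (n %/ k)%N @[n --> \oo] --> 0%E.
  exact: cvg_comp cvg_divn (Zc _ r20).
have pf n : p n \is a fin_num.
  by apply: fin_num_measure; apply: mdist; exact: estimator_random_element.
have le n : (P [set w | (eps < `|T n w - theta0|)%R] <=
    (k%:R * fine (p (n %/ k)%N))%:E)%E.
  have mT := mdist _ eps (quantile_estimator_random_element n).
  have mB i := mdist _ (r / 2) (block_random_element n i).
  rewrite -[leLHS]fineK ?fin_num_measure// lee_fin -mean_indic//.
  have -> : k%:R * fine (p (n %/ k)%N) = \int[P]_w (\sum_i
      (\1_[set w | r / 2 < `|B n i w - theta0|] w : R)).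
    rewrite mean_sum; last by move=> i; exact: bounded_measurable_indic.
    rewrite (eq_bigr (fun=> fine (p (n %/ k)%N))).
      by rewrite sumr_const card_ord mulr_natl.
    move=> i _; rewrite mean_indic//; congr fine.
    apply: (@block_law n i [set x | r / 2 < `|x - theta0|]).
    apply: open_borel; rewrite [X in open X](_ : _ = (fun x => `|x - theta0|) @^-1` `]r / 2, +oo[).
      apply: open_comp; last exact: interval_open.
      move=> v _; apply: cvg_norm; apply: cvgB; [exact: cvg_id|exact: cvg_cst].
    by apply/seteqP; split => x /=; rewrite in_itv/= andbT.
  apply: le_mean; first exact: bounded_measurable_indic.
    by apply: bounded_measurable_sum => i; exact: bounded_measurable_indic.
  move=> w; rewrite indicE; have [|_] := boolP (w \in _); last first.
    by apply: sumr_ge0 => i _; rewrite indicE ler0n.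
  rewrite inE/= => eT.
  have [i hi] : exists i, r / 2 < `|B n i w - theta0|.
    apply: contrapT => /forallNP H; move: eT; apply/negP; rewrite -leNgt ltW//.
    rewrite -[X in _ - X]schauder_quantile_cst.
    apply: le_lt_trans (HK _ _) (Hr _ _ _) => i.
    have /negP := H i; rewrite -leNgt => /le_lt_trans; apply.
    by rewrite ltr_pdivrMr// ltr_pMr// ltr1n.
  rewrite (bigD1 i)//= indicE mem_set//= lerDl.
  by apply: sumr_ge0 => j _; rewrite indicE ler0n.
apply: (@squeeze_cvge _ _ _ _ (fun=> 0%E) _ (fun n => (k%:R * fine (p (n %/ k)%N))%:E)).
- by near=> n; rewrite measure_ge0//=; exact: le.
- exact: cvg_cst.
- have h : (k%:R * fine (p (n %/ k)%N) : R) @[n --> \oo] --> (k%:R * 0 : R).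
    by apply: cvgM; [exact: cvg_cst|have /fine_cvgP[_] := pk].
  by rewrite mulr0 in h; apply/fine_cvgP; split; [exact: nearW|exact: h].
Unshelve. all: by end_near.
Qed.

Section Distribution.
Context (a : nat -> R) (ha : forall n, 0 <= a n)
   (dO1 : measure_display) (Omega1 : measurableType dO1)
   (P1 : probability Omega1 R) (Y : Omega1 -> X)
   (hY : cvg_in_distribution P (fun n w => a n *: (Z n w - theta0)) P1 Y)
   (dO2 : measure_display) (Omega2 : measurableType dO2)
   (P2 : probability Omega2 R) (Yc : 'I_k -> Omega2 -> X)
   (hYc : iid P2 (Yc : 'I_k -> Omega2 -> borel X))
   (hYcY : forall i, same_law P2 (Yc i : Omega2 -> borel X) P1 Y).

Local Notation V n := (fun i w => a (n %/ k)%N *: (B n i w - theta0)).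

(** Independence factors the mean of the product, and equality in law replaces
    each copy by Y, which may live on another space. *)
Lemma iid_copies_product_rule : product_rule P2 P1 Yc Y.
Proof.
have [mYc iYc _] := hYc; have [_ mY _] := hY.
have tm phi : test_fun phi -> measurable_fun setT (phi : borel X -> R).
  by move=> [cphi _]; exact: continuous_real_measurable.
move=> phi tphi.
rewrite (mean_prod (V := fun i => (Yc i : Omega2 -> borel X)))//.
- apply: eq_bigr => i _.
  apply: (same_law_mean (Z1 := (Yc i : Omega2 -> borel X)) (Z2 := (Y : _ -> borel X))) => //.
  by split; [exact: tm|exists 1; exact: test_fun_norm].
- by move=> A mA; exact: (mutually_independent_family iYc).
- by move=> i; split; [exact: tm|have [] := tphi i].
Qed.

Lemma blocks_product_rule n : product_rule P P (V n)
  (fun w => a (n %/ k)%N *: (Z (n %/ k)%N w - theta0)).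
Proof.
move=> phi tphi.
pose psi i (t : (n %/ k).-tuple E) := phi i (a (n %/ k)%N *: (g t - theta0)).
apply: (mean_blocks hxi (b := fun i j => @b n i j : nat) (phi := psi)).
  exact: block_injective.
move=> i; split; last by move=> t; have [_] := tphi i; exact.
apply: (measurableT_comp (continuous_real_measurable (tphi i).1)).
by apply: affine_random_element; exact: hg.
Qed.

(** The rescaled error of T is the quantile of the rescaled errors of the
    blocks, and composing a bounded Lipschitz function with the Lipschitz
    quantile map gives an admissible function of the k blocks. *)
Lemma quantile_estimator_weak_limit : cvg_in_distribution P
  (fun n w => a (n %/ k)%N *: (T n w - theta0))
  P2 (fun w => schauder_quantile d alpha (fun i => Yc i w)).
Proof.
have [mZ mY cZ] := hY; have [mYc _ _] := hYc.
have [e he] := schauder_basis_separable hd.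
have [K K0 HK] := schauder_quantile_lipschitz_ex.
have mT n : random_element (fun w => a (n %/ k)%N *: (T n w - theta0)).
  by apply: affine_random_element; exact: quantile_estimator_random_element.
have mq : random_element (fun w => qS (fun i => Yc i w)).
  exact: (random_vector_continuous he mYc HK).
split => // f cf bf.
have [M fM] := bounded_fun_le bf.
under eq_fun => n do rewrite (bounded_measurable_integral P (random_element_bounded (mT n) cf fM)).
rewrite (bounded_measurable_integral P2 (random_element_bounded mq cf fM)).
suff h : \int[P]_w f (a (n %/ k)%N *: (T n w - theta0)) @[n --> \oo] -->
    \int[P2]_w f (qS (fun i => Yc i w))
  by apply/fine_cvgP; split; [exact: nearW|exact: h].
move: f cf bf {M fM}; apply: portmanteau_lipschitz => // f [L [M [fL fM]]].
have TE n w : a (n %/ k)%N *: (T n w - theta0) = qS (fun i => V n i w).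
  rewrite (_ : (fun i => V n i w) = fun i => a (n %/ k)%N *: B n i w +
     (- (a (n %/ k)%N *: theta0))); last by apply/funext => i; rewrite scalerBr.
  by rewrite (schauder_quantile_affine hd hk halpha)// scalerBr.
have mB n i : random_element (V n i).
  by apply: affine_random_element; exact: block_random_element.
have ZY phi : test_fun phi ->
    \int[P]_w phi (a (n %/ k)%N *: (Z (n %/ k)%N w - theta0)) @[n --> \oo] -->
    \int[P1]_w phi (Y w).
  move=> tphi; have [cphi phi01] := tphi.
  have bphi : bounded_fun phi.
    exists 1; split => // r r1 x _.
    by apply: (le_trans (test_fun_norm tphi x)); exact: ltW.
  have := cZ phi cphi bphi.
  rewrite (bounded_measurable_integral P1
    (random_element_bounded mY cphi (test_fun_norm tphi))).
  move=> /fine_cvgP[_ h].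
  exact: (@cvg_comp _ _ _ (fun n => (n %/ k)%N)
    (fun m => \int[P]_w phi (a m *: (Z m w - theta0))) _ _ _ (@cvg_divn) h).
have C := product_weak_convergence he mB mYc mY blocks_product_rule
  iid_copies_product_rule ZY.
pose h (x : 'I_k -> X) := f (qS x).
have hM x : `|h x| <= M by exact: fM.
have hL x y : `|h x - h y| <= `|L| * K * \sum_i `|x i - y i|.
  rewrite (le_trans (fL _ _))// -mulrA.
  by rewrite (le_trans (ler_wpM2r _ (ler_norm L)))// ler_wpM2l// HK.
have G := C h M (`|L| * K) hM hL.
have TQ n : \int[P]_w f (a (n %/ k)%N *: (T n w - theta0)) =
    \int[P]_w h (fun i => V n i w).
  by apply: eq_Rintegral => w _; rewrite TE.
under eq_fun => n do rewrite TQ.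
exact: G.
Qed.

End Distribution.
End QuantileEstimator.

Unset Implicit Arguments.

Theorem theorem3p6 (R : realType) (X : completeNormedModType R)
    (d : nat -> X) (hd : unconditional_schauder_basis d)
    (theta0 : X) (k : nat) (hk : (0 < k)%N)
    (alpha : nat -> R) (halpha : forall l, 0 < alpha l < 1)
    (dO : measure_display) (Omega : measurableType dO) (P : probability Omega R)
    (dE : measure_display) (E : measurableType dE)
    (xi : nat -> Omega -> E) (hxi : iid P xi)
    (g : forall m : nat, m.-tuple E -> X)
    (hg : forall m : nat, random_element (g m))
    (b : forall n : nat, 'I_k -> 'I_(n %/ k) -> 'I_n)
    (hb : disjoint_blocks b) :
  let Z := estimator g xi in
  let T := schauder_quantile_estimator g xi d alpha b in
  (cvg_in_probability P Z theta0 -> cvg_in_probability P T theta0)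
  /\
  (forall (a : nat -> R),
     (forall n, 0 <= a n) -> a @ \oo --> +oo ->
   forall (dO1 : measure_display) (Omega1 : measurableType dO1)
     (P1 : probability Omega1 R) (Y : Omega1 -> X),
     cvg_in_distribution P (fun n w => a n *: (Z n w - theta0)) P1 Y ->
   forall (dO2 : measure_display) (Omega2 : measurableType dO2)
     (P2 : probability Omega2 R) (Yc : 'I_k -> Omega2 -> X),
     iid P2 (Yc : 'I_k -> Omega2 -> borel X) ->
     (forall i, same_law P2 (Yc i : Omega2 -> borel X) P1 Y) ->
     cvg_in_distribution P
       (fun n w => a (n %/ k)%N *: (T n w - theta0))
       P2 (fun w => schauder_quantile d alpha (fun i => Yc i w))).
Proof.
split.
  exact: quantile_estimator_consistent.
move=> a a0 _ dO1 Omega1 P1 Y hY dO2 Omega2 P2 Yc hYc hYcY.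
exact: (quantile_estimator_weak_limit hd hk halpha hxi hg hb a0 hY hYc hYcY).
Qed.
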